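(* Let $Q=R+S\in(\mathbb{R}_{\ge0}^n)^{\otimes k}$, where $R$ has constant rank and $S$ is polynomially sparse. Suppose that $R_{\max}$ and $S_{\max}$ are $O(1)$. Given $R$ in factored form, $S$ through its non-zero entries, measures $\mu_1,\dots,\mu_k\in\Delta_n$, and accuracy $\varepsilon>0$, we can compute in $\mathrm{poly}(n,k,1/\varepsilon)$ time a feasible $P\in\mathcal{M}(\mu_1,\dots,\mu_k)$ that has $\varepsilon$-suboptimal cost for the projection problem $$\min_{P\in\mathcal{M}(\mu_1,\dots,\mu_k)}\ \sum_{\vec{j}\in[n]^k}(P_{\vec{j}}-Q_{\vec{j}})^2.$$ This solution $P$ is a sparse tensor output through its $\mathrm{poly}(n,k,1/\varepsilon)$ non-zero entries.
   Context: $[n]=\{1,\dots,n\}$; $\Delta_n$ is the probability simplex in $\mathbb{R}^n$; $\vec{j}=(j_1,\dots,j_k)\in[n]^k$. For a tensor $A$, $A_{\max}=\max_{\vec{j}}|A_{\vec{j}}|$. $\mathcal{M}(\mu_1,\dots,\mu_k)=\{P\in(\mathbb{R}_{\ge0}^n)^{\otimes k}: m_i(P)=\mu_i\ \forall i\in[k]\}$, where $[m_i(P)]_j=\sum_{\vec{j}:\,j_i=j}P_{\vec{j}}$. $R$ has rank $r$ if $r$ is minimal such that $R=\sum_{\ell=1}^r\bigotimes_{i=1}^ku_{i,\ell}$ for some $u_{i,\ell}\in\mathbb{R}^n$; ''factored form'' means that such vectors are given. ''Polynomially sparse'' means having at most $\mathrm{poly}(n,k)$ non-zero entries. ''$\varepsilon$-suboptimal''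 means objective value at most $\varepsilon$ above the minimum. Inputs have bit complexity at most $\mathrm{poly}(n,k)$; runtimes count arithmetic operations. *)

(* Defs.v *)
From HB Require Import structures.
From mathcomp Require Import all_boot all_order all_algebra.
From mathcomp Require Import reals.

Set Implicit Arguments.
Unset Strict Implicit.
Unset Printing Implicit Defensive.

Import Order.TTheory GRing.Theory Num.Theory.
Local Open Scope ring_scope.

(** * Tensors of order [k] over [F], with indices in ['I_n] (0-based) *)

Definition multi_index (n k : nat) := k.-tuple 'I_n.

Definition tensor (F : Type) (n k : nat) := multi_index n k -> F.

Section Tensors.
Variables (F : realFieldType) (n k : nat).
Implicit Types (A P Q : tensor F n k) (mu : 'I_k -> 'I_n -> F).

Definition tensor_max A : F := \big[Num.max/0]_(j : multi_index n k) `|A j|.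

Definition marginal P (i : 'I_k) (a : 'I_n) : F :=
  \sum_(j : multi_index n k | tnth j i == a) P j.

Definition in_simplex (m : 'I_n -> F) : Prop :=
  (forall a, 0 <= m a) /\ \sum_a m a = 1.

Definition transport_polytope mu P : Prop :=
  (forall j, 0 <= P j) /\ (forall i a, marginal P i a = mu i a).

(** The tensor [\sum_l \bigotimes_i u l i]. *)
Definition factored r (u : 'I_r -> 'I_k -> 'I_n -> F) : tensor F n k :=
  fun j => \sum_(l < r) \prod_(i < k) u l i (tnth j i).

Definition decomposable A (r : nat) : Prop :=
  exists u : 'I_r -> 'I_k -> 'I_n -> F, A =1 factored u.

Definition has_rank A (r : nat) : Prop :=
  decomposable A r /\ (forall r', decomposable A r' -> (r <= r')%N).

Definition sq_dist P Q : F := \sum_(j : multi_index n k) (P j - Q j) ^+ 2.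

Definition suboptimal_projection mu Q (eps : F) P : Prop :=
  transport_polytope mu P /\
  (forall P', transport_polytope mu P' -> sq_dist P Q <= sq_dist P' Q + eps).

(** The tensor with non-zero entries listed in [s]. *)
Definition of_entries (s : seq (multi_index n k * F)) : tensor F n k :=
  fun j => \sum_(e <- s | e.1 == j) e.2.

Definition entry_list (s : seq (multi_index n k * F)) : bool :=
  uniq [seq e.1 | e <- s] && all (fun e => e.2 != 0) s.

End Tensors.

(** Inputs and outputs of algorithms are rational; minimization and rank are
    over the reals. *)
Definition to_real (R : realType) (n k : nat) (A : tensor rat n k) :
  tensor R n k := fun j => ratr (A j).

Definition bits (q : rat) : nat :=
  (up_log 2 `|numq q|%N.+1 + up_log 2 `|denq q|%N.+1)%N.

(** Up to the choice of [c], every bound [poly(n, k)] (resp.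
    [poly(n, k, 1/eps)]) for [n, k >= 1] and [eps > 0] has this shape. *)
Definition poly_nk (c n k : nat) : nat := (c * (n + k) ^ c)%N.

Definition poly_nk_eps (c n k : nat) (eps : rat) : rat :=
  c%:R * (n%:R + k%:R + eps^-1) ^+ c.

(** * Model of computation

    A first-order call-by-value language on binary trees with rational leaves.
    A program is a finite list of one-argument functions, possibly mutually
    recursive.  Each evaluation step costs one unit, be it an exact arithmetic
    operation, a comparison or a data or control step.  Trees are immutable, so
    that with pointers each step takes boundedly many operations of a random
    access machine with unit-cost field arithmetic.  There is no rounding
    operation and no primitive giving access to the bits of a number. *)

Inductive value :=
| VNum of rat
| VNil
| VCons of value & value.

Inductive arith := OpAdd | OpSub | OpMul | OpDiv.

(** Variables are de Bruijn indices. *)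
Inductive expr :=
| Var of nat
| Cst of rat
| Op of arith & expr & expr
| IfLe of expr & expr & expr & expr  (* if e1 <= e2 then e3 else e4 *)
| ENil
| ECons of expr & expr
| Match of expr & expr & expr        (* the last branch binds head, then tail *)
| Let of expr & expr
| Call of nat & expr.

Definition program := seq expr.

Definition apply_op (o : arith) (x y : rat) : option rat :=
  match o with
  | OpAdd => Some (x + y)
  | OpSub => Some (x - y)
  | OpMul => Some (x * y)
  | OpDiv => if y == 0 then None else Some (x / y)
  end.

(** [eval p env e v t]: in environment [env], [e] evaluates to [v] in [t]
    steps.  Ill-typed operations, division by zero and unbound names are
    stuck. *)
Inductive eval (p : program) : seq value -> expr -> value -> nat -> Prop :=
| EvVar env i v :
    onth env i = Some v -> eval p env (Var i) v 1
| EvCst env q :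
    eval p env (Cst q) (VNum q) 1
| EvOp env o e1 e2 x y z t1 t2 :
    eval p env e1 (VNum x) t1 -> eval p env e2 (VNum y) t2 ->
    apply_op o x y = Some z ->
    eval p env (Op o e1 e2) (VNum z) (t1 + t2).+1
| EvIfLe env e1 e2 e3 e4 x y v t1 t2 t3 :
    eval p env e1 (VNum x) t1 -> eval p env e2 (VNum y) t2 ->
    eval p env (if x <= y then e3 else e4) v t3 ->
    eval p env (IfLe e1 e2 e3 e4) v (t1 + t2 + t3).+1
| EvNil env :
    eval p env ENil VNil 1
| EvCons env e1 e2 v1 v2 t1 t2 :
    eval p env e1 v1 t1 -> eval p env e2 v2 t2 ->
    eval p env (ECons e1 e2) (VCons v1 v2) (t1 + t2).+1
| EvMatchNil env e e1 e2 v t1 t2 :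
    eval p env e VNil t1 -> eval p env e1 v t2 ->
    eval p env (Match e e1 e2) v (t1 + t2).+1
| EvMatchCons env e e1 e2 h tl v t1 t2 :
    eval p env e (VCons h tl) t1 -> eval p [:: h, tl & env] e2 v t2 ->
    eval p env (Match e e1 e2) v (t1 + t2).+1
| EvLet env e1 e2 v1 v t1 t2 :
    eval p env e1 v1 t1 -> eval p (v1 :: env) e2 v t2 ->
    eval p env (Let e1 e2) v (t1 + t2).+1
| EvCall env f e body v w t1 t2 :
    eval p env e v t1 -> onth p f = Some body -> eval p [:: v] body w t2 ->
    eval p env (Call f e) w (t1 + t2).+1.

(** The function of index 0 is the entry point. *)
Definition computes (p : program) (input output : value) (t : nat) : Prop :=
  eval p [:: input] (Call 0 (Var 0)) output t.

(** * Encoding of inputs and outputs *)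

Definition enc_list (s : seq value) : value := foldr VCons VNil s.

Definition enc_nat (m : nat) : value := VNum m%:R.

Definition enc_fun (m : nat) (f : 'I_m -> value) : value :=
  enc_list [seq f i | i <- enum 'I_m].

Definition enc_index (n k : nat) (j : multi_index n k) : value :=
  enc_list [seq enc_nat (a : 'I_n) | a <- j].

Definition enc_entries (n k : nat) (s : seq (multi_index n k * rat)) : value :=
  enc_list [seq VCons (enc_index e.1) (VNum e.2) | e <- s].

Definition enc_input (n k r : nat) (u : 'I_r -> 'I_k -> 'I_n -> rat)
    (s : seq (multi_index n k * rat)) (mu : 'I_k -> 'I_n -> rat) (eps : rat) :
    value :=
  enc_list [:: enc_nat n; enc_nat k;
    enc_fun (fun l => enc_fun (fun i => enc_fun (fun a => VNum (u l i a))));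
    enc_entries s;
    enc_fun (fun i => enc_fun (fun a => VNum (mu i a)));
    VNum eps].

(* Main.v *)
Require Import Defs.
From mathcomp Require Import all_boot all_order all_algebra.
From mathcomp Require Import reals.
From mathcomp Require Import zify ring lra.

(** The cost |P - Q|^2 is minimized through the penalized cost
      F(P) = |P - Q|^2 + lam * sum_(i, a) (mu_i(a) - m_i(P)(a))^2
    on nonnegative tensors of mass at most one.  A feasible competitor pays no
    penalty, so the infimum of F is at most the optimum.  Conversely, a tensor
    P with marginals close to mu is turned into a feasible one at l1 distance
    at most 3 * sum_(i, a) |mu_i(a) - m_i(P)(a)| ([rounding_spec]); as Q is
    bounded the cost is Lipschitz in the l1 norm, and by the inequality between
    arithmetic and geometric means the penalty absorbs the loss up to an
    additive constant proportional to 1 / lam ([rounded_cost]).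

    F is minimized by the Frank-Wolfe method, starting at the zero tensor: each
    of the s^2 rounds moves a fraction 1 / s of the way to a single entry of
    mass one, so the iterate stays sparse, and the error is governed by a
    curvature of order lam * k, not by the n^k coordinates
    ([frank_wolfe_step], [gap_final]).

    A round has to find a multi-index j that nearly maximizes the score
      R_j + S_j - P_j + lam * sum_i c_i(j_i),  c_i(a) = mu_i(a) - m_i(P)(a).
    The factors of R may be huge and cancel, so they cannot be rounded; all
    that is used is that the entries of R are bounded.  For a large number N
    the product
      (N + R_j + S_j - P_j) * prod_i (N + lam * c_i(j_i))
    is N^(k+1) + N^k * score up to second order ([bracket_approx]).  The sum of
    its D-th powers over a box of multi-indices can be computed exactly: on the
    binomial expansion of (N + R_j)^D, taken one rank-one term after the other,
    the sum over j factors into k sums over one coordinate, and there are at most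
    (D + 1)^r terms ([power_sumE]); the entries of the sparse part S - P are
    corrected one by one ([potentialE]).  If the coordinates of j are fixed one
    at a time, keeping at least the fraction 1 / n of the sum each time, then
    the D-th power of the product at j is at least n^(- k) times the maximum
    ([greedy_index_max]), and for D large this is a factor close to one before
    the power is taken ([root_gap], [oracle_accuracy]).

    For the rounding, the entries of P are poured one after the other into
    matrices of remaining capacities, which are the marginals mu at the start;
    what does not fit is charged to the capacity that is exhausted
    ([pourall_spec]).  The capacities left over are used up by a north-west
    corner rule, with at most n * k more entries ([fill_corners_spec]).

    On the side of the computation, arithmetic is exact and costs one step per
    operation, so only the number of steps matters.  Each function of the
    program has a mathematical counterpart and a lemma, whose name ends in
    _runs, which says that it computes the counterpart in at most X^e steps for
    a fixed e, where X bounds all the sizes involved; the exponent of the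
    oracle grows with the rank.  X itself is polynomial in n, k and 1 / eps
    ([poly_resource]). *)

Set Implicit Arguments.
Unset Strict Implicit.
Unset Printing Implicit Defensive.

Import Order.TTheory GRing.Theory Num.Theory.
Local Open Scope ring_scope.

(** * Frank-Wolfe on the penalized objective *)

Lemma bernoulli (F : realFieldType) (x : F) m :
  0 <= x -> 1 + m%:R * x <= (1 + x) ^+ m.
Proof.
move=> x0; elim: m => [|m IHm]; first by rewrite mul0r addr0 expr0.
rewrite exprS; apply: le_trans (ler_wpM2l _ IHm); last by rewrite addr_ge0.
have : 0 <= m%:R * x * x by rewrite !mulr_ge0.
rewrite -natr1; nra.
Qed.

Lemma sum_le_const (F : realFieldType) m (f : 'I_m -> F) c :
  (forall i, f i <= c) -> \sum_i f i <= c * m%:R.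
Proof.
move=> hf; apply: (@le_trans _ _ (\sum_(i < m) c)); first exact: ler_sum.
by rewrite sumr_const card_ord mulr_natr.
Qed.

Section FrankWolfe.
Variables (F : realFieldType) (n k : nat).
Notation idx := (multi_index n k).
Notation tensor := (tensor F n k).
Implicit Types (P D Q : tensor).

Definition point (j : idx) : tensor := fun j' => (j' == j)%:R.

Definition residual (mu : 'I_k -> 'I_n -> F) P i a := mu i a - marginal P i a.

Definition penalized lam mu Q P : F :=
  sq_dist P Q + lam * \sum_i \sum_a residual mu P i a ^+ 2.

(** Half of the negative gradient of [penalized] at [P]. *)
Definition score lam mu Q P : tensor := fun j =>
  Q j - P j + lam * \sum_i residual mu P i (tnth j i).

Lemma sum_marginal P i : \sum_a marginal P i a = \sum_j P j.
Proof. by rewrite [RHS](partition_big (fun j : idx => tnth j i) predT). Qed.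

Lemma sum_point (G : tensor) j : \sum_j' point j j' * G j' = G j.
Proof.
rewrite (bigD1 j) //= /point eqxx mul1r big1 ?addr0 // => j' /negbTE ->.
by rewrite mul0r.
Qed.

(** The adjoint of the marginal map sends [C] to a sum of one-variable
    functions, the shape in which the penalty enters the gradient. *)
Lemma marginal_pairing P (C : 'I_k -> 'I_n -> F) :
  \sum_i \sum_a C i a * marginal P i a = \sum_j P j * \sum_i C i (tnth j i).
Proof.
under [RHS]eq_bigr do rewrite mulr_sumr.
rewrite [RHS]exchange_big /=; apply: eq_bigr => i _.
rewrite [RHS](partition_big (fun j : idx => tnth j i) predT) //=.
apply: eq_bigr => a _; rewrite mulr_sumr; apply: eq_bigr => j /eqP ->.
exact: mulrC.
Qed.

Lemma marginal_lin P D t i a :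
  marginal (fun j => P j + t * D j) i a = marginal P i a + t * marginal D i a.
Proof. by rewrite /marginal big_split mulr_sumr. Qed.

(** The penalized cost is quadratic, so its second order expansion is exact; it
    is used both along the step that is taken and towards the competitor. *)
Lemma penalized_expand lam mu Q P D t :
  penalized lam mu Q (fun j => P j + t * D j) =
  penalized lam mu Q P - 2 * t * \sum_j D j * score lam mu Q P j +
  t ^+ 2 * (\sum_j D j ^+ 2 + lam * \sum_i \sum_a marginal D i a ^+ 2).
Proof.
have -> : \sum_j D j * score lam mu Q P j =
    \sum_j D j * (Q j - P j) +
    lam * \sum_i \sum_a residual mu P i a * marginal D i a.
  rewrite marginal_pairing mulr_sumr -big_split /=; apply: eq_bigr => j _.
  by rewrite /score mulrDr mulrCA.
have e1 : sq_dist (fun j => P j + t * D j) Q = sq_dist P Q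
    - 2 * t * \sum_j D j * (Q j - P j) + t ^+ 2 * \sum_j D j ^+ 2.
  rewrite /sq_dist !mulr_sumr -sumrB -big_split /=.
  by apply: eq_bigr => j _; ring.
have e2 : \sum_i \sum_a residual mu (fun j => P j + t * D j) i a ^+ 2 =
    \sum_i \sum_a residual mu P i a ^+ 2
    - 2 * t * (\sum_i \sum_a residual mu P i a * marginal D i a)
    + t ^+ 2 * \sum_i \sum_a marginal D i a ^+ 2.
  rewrite !mulr_sumr -sumrB -big_split /=; apply: eq_bigr => i _.
  rewrite !mulr_sumr -sumrB -big_split /=; apply: eq_bigr => a _.
  by rewrite /residual marginal_lin; ring.
by rewrite /penalized e1 e2; ring.
Qed.

Lemma marginal_point j i a : marginal (point j) i a = (tnth j i == a)%:R.
Proof.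
rewrite /marginal; have [e|ne] := eqVneq (tnth j i) a.
  rewrite (bigD1 j) ?e //= /point eqxx big1 ?addr0 // => j' /andP[_ /negbTE ->].
  by [].
rewrite big1 // => j' /eqP e; rewrite /point; case: eqP => // ej.
by rewrite -e ej eqxx in ne.
Qed.

Definition subdistribution P := (forall j, 0 <= P j) /\ \sum_j P j <= 1.

Lemma subdist_le1 P j : subdistribution P -> P j <= 1.
Proof.
move=> [P0 P1]; apply: le_trans P1; rewrite (bigD1 j) //= lerDl.
exact: sumr_ge0.
Qed.

Lemma marginal_ge0 P i a : (forall j, 0 <= P j) -> 0 <= marginal P i a.
Proof. by move=> P0; apply: sumr_ge0. Qed.

Lemma marginal_le1 P i a : subdistribution P -> marginal P i a <= 1.
Proof.
move=> [P0 P1]; apply: le_trans P1; rewrite -(sum_marginal P i) (bigD1 a) //=.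
by rewrite lerDl sumr_ge0 // => a' _; apply: marginal_ge0.
Qed.

Lemma sqrB_le (x y : F) : 0 <= x <= 1 -> 0 <= y <= 1 -> (x - y) ^+ 2 <= x + y.
Proof. move=> /andP[? ?] /andP[? ?]; nra. Qed.

(** All the entries and marginals compared lie in [0, 1], where
    (x - y)^2 <= x + y; the bound is then a matter of total mass and does not
    see the number of entries. *)
Lemma curvature_bound lam P j : 0 <= lam -> subdistribution P ->
  \sum_j' (point j j' - P j') ^+ 2 +
  lam * \sum_i \sum_a marginal (fun j' => point j j' - P j') i a ^+ 2 <=
  2 + 2 * lam * k%:R.
Proof.
move=> lam0 sP; pose D : tensor := fun j' => point j j' - P j'; have [P0 P1] := sP.
have sum1 (T : finType) (x : T) : \sum_y (x == y)%:R = 1 :> F.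
  by rewrite (bigD1 x) //= eqxx big1 ?addr0 // => y; rewrite eq_sym => /negbTE ->.
have b01 (c : bool) : 0 <= c%:R <= (1 : F) by case: c; rewrite ?lexx ler01.
have h1 : \sum_j' (point j j' - P j') ^+ 2 <= 2.
  apply: (@le_trans _ _ (\sum_j' (point j j' + P j'))).
    apply: ler_sum => j' _; apply: sqrB_le; first exact: b01.
    by rewrite P0 subdist_le1.
  rewrite big_split /=; have : \sum_j' point j j' = 1.
    by rewrite /point; under eq_bigr do rewrite eq_sym; apply: sum1.
  lra.
rewrite -[fun j' => _ - _]/D.
suff h2 : \sum_i \sum_a marginal D i a ^+ 2 <= 2 * k%:R.
  by move: (ler_wpM2l lam0 h2); lra.
apply: sum_le_const => i.
apply: (@le_trans _ _ (\sum_a ((tnth j i == a)%:R + marginal P i a))).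
  apply: ler_sum => a _.
  have -> : marginal D i a = (tnth j i == a)%:R - marginal P i a.
    by rewrite -marginal_point /marginal -sumrB.
  apply: sqrB_le; first exact: b01.
  by rewrite marginal_ge0 //= marginal_le1.
by rewrite big_split /= sum1 sum_marginal; lra.
Qed.

(** Convexity bounds the excess of [P] over the competitor by the slope of the
    penalized cost towards the competitor.  The slope towards the chosen entry
    is as good up to [delta], since the competitor is an average of entries;
    what is lost is the second order term. *)
Lemma frank_wolfe_step lam mu Q P Pstar j delta g : 0 <= lam -> 0 <= g <= 1 ->
  subdistribution P -> (forall j', score lam mu Q P j' <= score lam mu Q P j + delta) ->
  transport_polytope mu Pstar -> \sum_j Pstar j = 1 ->
  penalized lam mu Q (fun j' => P j' + g * (point j j' - P j')) - sq_dist Pstar Q <=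
  (1 - g) * (penalized lam mu Q P - sq_dist Pstar Q) +
  g * (2 * delta + g * (2 + 2 * lam * k%:R)).
Proof.
move=> lam0 /andP[g0 g1] sP hj [Ps0 Psm] Ps1.
rewrite penalized_expand.
set H := score lam mu Q P; set c := _ + lam * _.
have hc : c <= 2 + 2 * lam * k%:R := curvature_bound j lam0 sP.
have hs : penalized lam mu Q P - sq_dist Pstar Q <= 2 * \sum_j (Pstar j - P j) * H j.
  have := penalized_expand lam mu Q P (fun j => Pstar j - P j) 1.
  have -> : penalized lam mu Q (fun j => P j + 1 * (Pstar j - P j)) = sq_dist Pstar Q.
    rewrite /penalized [X in _ + lam * X]big1 => [|i _]; first last.
      rewrite big1 // => a _; rewrite /residual -Psm /marginal -sumrB big1 ?expr0n //.
      by move=> j' _; rewrite mul1r addrCA subrr addr0 subrr.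
    rewrite mulr0 addr0; apply: eq_bigr => j' _.
    by rewrite mul1r addrCA subrr addr0.
  rewrite expr1n mul1r mulr1 => ->.
  have : 0 <= \sum_j (Pstar j - P j) ^+ 2 +
      lam * \sum_i \sum_a marginal (fun j => Pstar j - P j) i a ^+ 2.
    rewrite addr_ge0 ?mulr_ge0 //; apply: sumr_ge0 => ? _; rewrite ?sqr_ge0 //.
    by apply: sumr_ge0 => ? _; rewrite sqr_ge0.
  rewrite -/H; lra.
have hd : \sum_j (Pstar j - P j) * H j <= \sum_j' (point j j' - P j') * H j' + delta.
  have split_sum (A B : tensor) : \sum_j (A j - B j) * H j =
      \sum_j A j * H j - \sum_j B j * H j.
    by rewrite -sumrB; apply: eq_bigr => ? _; rewrite mulrBl.
  rewrite !split_sum sum_point.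
  have : \sum_j Pstar j * H j <= \sum_j' Pstar j' * (H j + delta).
    by apply: ler_sum => j' _; rewrite ler_wpM2l.
  by rewrite -mulr_suml Ps1 mul1r; lra.
set S := \sum_j' (point j j' - P j') * H j' in hd *.
have : g ^+ 2 * c <= g ^+ 2 * (2 + 2 * lam * k%:R) by rewrite ler_wpM2l ?sqr_ge0.
have : g * (penalized lam mu Q P - sq_dist Pstar Q) <= g * (2 * (S + delta)).
  by rewrite ler_wpM2l //; apply: le_trans hs _; rewrite ler_pM2l.
set p := penalized _ _ _ _; set q := sq_dist _ _; set x := 2 + _.
nra.
Qed.

Lemma contraction (h : nat -> F) g e K m : 0 <= g <= 1 -> 0 <= e ->
  (forall t, h t.+1 <= (1 - g) * h t + g * e) -> h 0%N <= K ->
  h m <= (1 - g) ^+ m * K + e.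
Proof.
move=> /andP[g0 g1] e0 hS h0.
have g1' : 0 <= 1 - g by rewrite subr_ge0.
elim: m => [|m IHm]; first by rewrite expr0 mul1r; lra.
apply: le_trans (hS m) _.
have := ler_wpM2l g1' IHm; rewrite exprS; lra.
Qed.

(** Since (1 - 1/s) (1 + 1/s) <= 1, the power is at most the inverse of
    (1 + 1/s)^(s^2), which is at least s by Bernoulli's inequality. *)
Lemma decay (s : nat) : (0 < s)%N ->
  (1 - s%:R^-1) ^+ (s * s) <= s%:R^-1 :> F.
Proof.
move=> s0; have sp : 0 < s%:R :> F by rewrite ltr0n.
have ip : 0 < s%:R^-1 :> F by rewrite invr_gt0.
have i1 : s%:R^-1 <= 1 :> F by rewrite invf_le1 // ler1n.
have h : s%:R <= (1 + s%:R^-1) ^+ (s * s) :> F.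
  apply: le_trans (bernoulli _ (ltW ip)); rewrite natrM mulfK ?gt_eqF //; lra.
have h2 : (1 - s%:R^-1) ^+ (s * s) * (1 + s%:R^-1) ^+ (s * s) <= 1 :> F.
  rewrite -exprMn exprn_ile1 //; last by nra.
  by apply: mulr_ge0; lra.
have h3 : 0 <= (1 - s%:R^-1) ^+ (s * s) :> F by rewrite exprn_ge0 // subr_ge0.
rewrite -[leRHS]mul1r ler_pdivlMr //; apply: le_trans h2.
exact: ler_wpM2l.
Qed.

Lemma sq_dist_lipschitz L P P' Q :
  (forall j, `|P j + P' j - 2 * Q j| <= L) ->
  sq_dist P' Q <= sq_dist P Q + L * \sum_j `|P' j - P j|.
Proof.
move=> hL; rewrite mulr_sumr /sq_dist -big_split /=; apply: ler_sum => j _.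
rewrite -lerBlDl.
have -> : (P' j - Q j) ^+ 2 - (P j - Q j) ^+ 2 =
   (P j + P' j - 2 * Q j) * (P' j - P j) by ring.
by apply: le_trans (ler_norm _) _; rewrite normrM ler_wpM2r.
Qed.

(** Trades a violation of the marginals that is paid linearly, as rounding
    does, for one that is paid quadratically, as the penalty does. *)
Lemma amgm (c lam x : F) : 0 < lam -> c * `|x| <= lam * x ^+ 2 + c ^+ 2 / (4 * lam).
Proof.
move=> lam0; rewrite -real_normK ?num_real //; set y := `|x|.
have : 0 <= (2 * lam * y - c) ^+ 2 / (4 * lam).
  by rewrite divr_ge0 ?sqr_ge0 // mulr_ge0 // ltW.
have -> : (2 * lam * y - c) ^+ 2 / (4 * lam) =
   lam * y ^+ 2 + c ^+ 2 / (4 * lam) - c * y by field; rewrite gt_eqF.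
lra.
Qed.

End FrankWolfe.

(** * Maximizing a sum through powers of a product *)

(** The product replaces a sum of one-variable functions by something whose
    powers factor over the coordinates, at the price of a second order error. *)
Lemma prod_linearize (F : realFieldType) (xs : seq F) :
  \sum_(x <- xs) `|x| <= 1 ->
  `|\prod_(x <- xs) (1 + x) - 1 - \sum_(x <- xs) x| <= (\sum_(x <- xs) `|x|) ^+ 2.
Proof.
elim: xs => [|x xs IHxs]; first by rewrite !big_nil !subr0 subrr normr0 expr0n.
rewrite !big_cons => h.
have x0 := normr_ge0 x.
have a0 : 0 <= \sum_(z <- xs) `|z| by apply: sumr_ge0.
have hs : `|\sum_(z <- xs) z| <= \sum_(z <- xs) `|z| by apply: ler_norm_sum.
have {IHxs} IHxs := IHxs ltac:(lra).
set p := \prod_(z <- xs) _ in IHxs *; set s := \sum_(z <- xs) z in IHxs hs *.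
set a := \sum_(z <- xs) `|z| in a0 h hs IHxs *.
have -> : (1 + x) * p - 1 - (x + s) = (p - 1 - s) + x * s + x * (p - 1 - s) by ring.
apply: le_trans (ler_normD _ _) _; rewrite normrM.
have := ler_normD (p - 1 - s) (x * s); rewrite normrM.
have : `|x| * `|s| <= `|x| * a by rewrite ler_wpM2l.
have : `|x| * `|p - 1 - s| <= `|x| * a ^+ 2 by rewrite ler_wpM2l.
have : `|x| * a ^+ 2 <= `|x| * a by rewrite ler_wpM2l // expr2 ler_piMl //; lra.
nra.
Qed.

(** A factor [n ^ k] lost on a power of order [k * n * th] is a factor at most
    [1 + 1 / th] on the base, as (1 + 1/th)^(n * th) >= n. *)
Lemma root_gap (F : realFieldType) (n k th : nat) (x y : F) : (0 < th)%N ->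
  0 < x -> y ^+ (k * n * th) <= n%:R ^+ k * x ^+ (k * n * th) ->
  (0 < k)%N -> y <= (1 + th%:R^-1) * x.
Proof.
move=> th0 x0 h k0; rewrite leNgt; apply/negP => lt_y.
have t0 : 0 < th%:R^-1 :> F by rewrite invr_gt0 ltr0n.
have z0 : 0 < (1 + th%:R^-1) * x by rewrite mulr_gt0 // addr_gt0.
case: n h => [|n] h.
  by rewrite muln0 mul0n !expr0 mulr1 expr0n gtn_eqF //= ler10 in h.
have d0 : (0 < k * n.+1 * th)%N by rewrite !muln_gt0 k0.
have : ((1 + th%:R^-1) * x) ^+ (k * n.+1 * th) < y ^+ (k * n.+1 * th).
  by rewrite ltrXn2r -?lt0n // ltW.
apply/negP; rewrite -leNgt; apply: le_trans h _.
rewrite exprMn ler_pM2r ?exprn_gt0 // -mulnA (mulnC k) exprM.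
rewrite lerXn2r ?nnegrE ?exprn_ge0 ?addr_ge0 ?(ltW t0) //.
apply: le_trans (bernoulli _ (ltW t0)).
by rewrite natrM mulfK ?lerDr // pnatr_eq0 -lt0n.
Qed.

Section Oracle.
Variables (F : realFieldType) (n k : nat).
Notation idx := (multi_index n k).
Variables (y : idx -> F) (c : 'I_k -> 'I_n -> F).
Variables (La M : nat).
Let N := (32 * (La * La * M))%N.
Let th := (32 * N * M)%N.
Hypotheses (La0 : (0 < La)%N) (M0 : (0 < M)%N) (k0 : (0 < k)%N).
Hypothesis hLa : forall j, `|y j| + \sum_i `|c i (tnth j i)| <= La%:R.

(** For [N] large, [bracket j / N ^ k.+1] is one plus
    [(y j + \sum_i c i (tnth j i)) / N] up to a second order term. *)
Definition bracket (j : idx) := (N%:R + y j) * \prod_i (N%:R + c i (tnth j i)).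

Let rho : F := La%:R / N%:R.
Let La1 : 1 <= La%:R :> F. Proof. by rewrite ler1n. Qed.
Let M1 : 1 <= M%:R :> F. Proof. by rewrite ler1n. Qed.
Let N_def : N%:R = 32 * (La%:R * La%:R * M%:R) :> F.
Proof. by rewrite /N !natrM. Qed.
Let N_gt0 : 0 < N%:R :> F.
Proof. by rewrite ltr0n /N !muln_gt0 La0 M0. Qed.
Let rho_ge0 : 0 <= rho. Proof. by rewrite divr_ge0. Qed.
Let rho_small : rho <= 32^-1.
Proof.
rewrite ler_pdivrMr // N_def mulKf ?pnatr_eq0 //.
by rewrite -mulrA ler_peMr ?mulr_ege1.
Qed.

Let xs j : seq F := y j / N%:R :: [seq c i (tnth j i) / N%:R | i <- enum 'I_k].

Definition rel_bracket j : F := \prod_(x <- xs j) (1 + x).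

Lemma bracketE j : bracket j = N%:R ^+ k.+1 * rel_bracket j.
Proof.
rewrite /rel_bracket /bracket /xs big_cons big_map exprS mulrACA.
have e (t : F) : N%:R + t = N%:R * (1 + t / N%:R) by field; rewrite gt_eqF.
congr (_ * _); first exact: e.
rewrite big_enum /=; under eq_bigr do rewrite e.
by rewrite big_split /= prodr_const card_ord.
Qed.

Lemma bracket_approx j :
  `|rel_bracket j - 1 - (y j + \sum_i c i (tnth j i)) / N%:R| <= rho ^+ 2.
Proof.
have e : \sum_(x <- xs j) `|x| <= rho.
  rewrite /xs big_cons big_map big_enum /= /rho.
  rewrite ler_pdivlMr // mulrDl mulr_suml; apply: le_trans (hLa j).
  rewrite normrM mulrAC normfV normr_nat mulfK ?gt_eqF // lerD2l.
  apply: ler_sum => i _.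
  by rewrite normrM mulrAC normfV normr_nat mulfK ?gt_eqF.
have e' : \sum_(x <- xs j) x = (y j + \sum_i c i (tnth j i)) / N%:R.
  by rewrite /xs big_cons big_map big_enum /= mulrDl mulr_suml.
rewrite -e'; apply: le_trans (prod_linearize _) _; first by have := rho_small; lra.
by rewrite lerXn2r ?nnegrE // sumr_ge0.
Qed.

Lemma bracket_bounds j : 0 < rel_bracket j <= 2.
Proof.
have := bracket_approx j.
have : `|(y j + \sum_i c i (tnth j i)) / N%:R| <= rho.
  rewrite normrM normfV normr_nat ler_wpM2r ?invr_ge0 //.
  apply: le_trans (hLa j); apply: le_trans (ler_normD _ _) _.
  by rewrite lerD2l ler_norm_sum.
set z := _ / _; move: rho_ge0 rho_small; rewrite !ler_norml => h0 h1 /andP[h2 h3] /andP[h4 h5].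
have : rho ^+ 2 <= 32^-1 by rewrite expr2; nra.
by move=> h6; apply/andP; split; lra.
Qed.

(** [N] is so large that linearizing a relative bracket costs at most
    [1 / (32 * M)] in units of [1 / N], and [th] so large that [th^-1] is the
    same quantity.  Two brackets are linearized, and the loss of [root_gap]
    counts twice because relative brackets are at most 2. *)
Lemma oracle_accuracy j j' :
  bracket j' ^+ (k * n * th) <= n%:R ^+ k * bracket j ^+ (k * n * th) ->
  y j' + \sum_i c i (tnth j' i) <= y j + \sum_i c i (tnth j i) + (8 * M%:R)^-1.
Proof.
rewrite !bracketE.
have /andP[b0 b2] := bracket_bounds j; have := bracket_approx j.
have := bracket_approx j'.
set b := rel_bracket j in b0 b2 *; set b' := rel_bracket j'.
set h := y j + _; set h' := y j' + _ => /= ha' ha hp.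
have Np : 0 < N%:R ^+ k.+1 ^+ (k * n * th) :> F by rewrite !exprn_gt0.
have th0 : (0 < th)%N by rewrite /th /N !muln_gt0 La0 M0.
have gap : b' <= (1 + th%:R^-1) * b.
  apply: (@root_gap _ n k th) => //.
  by move: hp; rewrite !exprMn mulrCA ler_pM2l.
have thE : th%:R^-1 = (32 * M%:R)^-1 / N%:R :> F.
  by rewrite -invfM /th !natrM mulrAC.
move: ha ha'; rewrite !ler_norml => /andP[_ h1] /andP[h2 _].
have hr : rho ^+ 2 = (32 * M%:R)^-1 / N%:R.
  rewrite /rho N_def; field.
  by rewrite !(gt_eqF, lt_le_trans ltr01).
have : h' / N%:R <= h / N%:R + (4 * (32 * M%:R)^-1) / N%:R.
  have : th%:R^-1 * b <= 2 * th%:R^-1 by rewrite mulrC ler_wpM2r // invr_ge0.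
  rewrite -[4 * _ / _]mulrA -thE; rewrite -thE in hr; lra.
rewrite -mulrDl ler_pM2r ?invr_gt0 //.
have -> : 4 * (32 * M%:R)^-1 = (8 * M%:R)^-1 :> F.
  by field; rewrite gt_eqF // (lt_le_trans ltr01).
by [].
Qed.

End Oracle.

(** * Evaluation with a bound on the number of steps *)

Definition hd (e : expr) := Match e ENil (Var 0).
Definition tl (e : expr) := Match e ENil (Var 1).
(** Functions take their arguments packed in a list; under [x] bindings made
    since the call, the list is variable [x]. *)
Definition arg (i x : nat) := hd (iter i tl (Var x)).
Definition args (es : seq expr) := foldr ECons ENil es.
Definition IfEq e1 e2 e3 e4 := IfLe e1 e2 (IfLe e2 e1 e3 e4) e4.

Section Bounded.
Variable p : program.

(** Bounds rather than exact costs: branches of different cost can then share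
    one bound. *)
Definition ev env e v T := exists2 t, (t <= T)%N & eval p env e v t.

Definition runs f v w T :=
  exists2 body, onth p f = Some body & ev [:: v] body w T.

Lemma ev_weaken env e v w T T' :
  ev env e v T -> v = w -> (T <= T')%N -> ev env e w T'.
Proof. by move=> [t le_t et] <- leT; exists t => //; apply: leq_trans leT. Qed.

Lemma ev_var env i v : onth env i = Some v -> ev env (Var i) v 1.
Proof. by move=> h; exists 1%N => //; constructor. Qed.

Lemma ev_cst env q : ev env (Cst q) (VNum q) 1.
Proof. by exists 1%N => //; constructor. Qed.

Lemma ev_nil env : ev env ENil VNil 1.
Proof. by exists 1%N => //; constructor. Qed.

Lemma ev_op env o e1 e2 x y z T1 T2 :
  ev env e1 (VNum x) T1 -> ev env e2 (VNum y) T2 -> apply_op o x y = Some z ->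
  ev env (Op o e1 e2) (VNum z) (T1 + T2).+1.
Proof.
move=> [t1 l1 h1] [t2 l2 h2] hz.
by exists (t1 + t2).+1; [rewrite ltnS leq_add | apply: EvOp h1 h2 hz].
Qed.

Lemma ev_div env e1 e2 x y T1 T2 :
  ev env e1 (VNum x) T1 -> ev env e2 (VNum y) T2 -> y != 0 ->
  ev env (Op OpDiv e1 e2) (VNum (x / y)) (T1 + T2).+1.
Proof. by move=> h1 h2 hy; apply: ev_op h1 h2 _ => /=; rewrite (negbTE hy). Qed.

Lemma ev_cons env e1 e2 v1 v2 T1 T2 :
  ev env e1 v1 T1 -> ev env e2 v2 T2 ->
  ev env (ECons e1 e2) (VCons v1 v2) (T1 + T2).+1.
Proof.
move=> [t1 l1 h1] [t2 l2 h2].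
by exists (t1 + t2).+1; [rewrite ltnS leq_add | apply: EvCons h1 h2].
Qed.

Lemma ev_let env e1 e2 v1 v T1 T2 :
  ev env e1 v1 T1 -> ev (v1 :: env) e2 v T2 ->
  ev env (Let e1 e2) v (T1 + T2).+1.
Proof.
move=> [t1 l1 h1] [t2 l2 h2].
by exists (t1 + t2).+1; [rewrite ltnS leq_add | apply: EvLet h1 h2].
Qed.

Lemma ev_match_nil env e e1 e2 v T1 T2 :
  ev env e VNil T1 -> ev env e1 v T2 -> ev env (Match e e1 e2) v (T1 + T2).+1.
Proof.
move=> [t1 l1 h1] [t2 l2 h2].
by exists (t1 + t2).+1; [rewrite ltnS leq_add | apply: EvMatchNil h1 h2].
Qed.

Lemma ev_match_cons env e e1 e2 h t v T1 T2 :
  ev env e (VCons h t) T1 -> ev [:: h, t & env] e2 v T2 ->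
  ev env (Match e e1 e2) v (T1 + T2).+1.
Proof.
move=> [t1 l1 h1] [t2 l2 h2].
by exists (t1 + t2).+1; [rewrite ltnS leq_add | apply: EvMatchCons h1 h2].
Qed.

Lemma ev_ifle env e1 e2 e3 e4 x y v T1 T2 T3 :
  ev env e1 (VNum x) T1 -> ev env e2 (VNum y) T2 ->
  ev env (if x <= y then e3 else e4) v T3 ->
  ev env (IfLe e1 e2 e3 e4) v (T1 + T2 + T3).+1.
Proof.
move=> [t1 l1 h1] [t2 l2 h2] [t3 l3 h3].
by exists (t1 + t2 + t3).+1; [rewrite ltnS !leq_add | apply: EvIfLe h1 h2 h3].
Qed.

(** The cost is doubled because up to two comparisons are made, each evaluating
    both sides. *)
Lemma ev_ifeq env e1 e2 e3 e4 x y v T1 T2 T3 :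
  ev env e1 (VNum x) T1 -> ev env e2 (VNum y) T2 ->
  ev env (if x == y then e3 else e4) v T3 ->
  ev env (IfEq e1 e2 e3 e4) v (T1 + T2 + (T1 + T2 + T3).+1).+1.
Proof.
move=> h1 h2 h3; apply: (ev_ifle h1 h2).
case: (leP x y) => [le_xy | lt_yx].
  rewrite (addnC T1) in h3 *; apply: (ev_ifle h2 h1).
  by move: h3; rewrite eq_le le_xy.
move: h3; rewrite (gt_eqF lt_yx) => h3; apply: (ev_weaken h3) => //.
by lia.
Qed.

(** The conditional moves into the value, so that what follows is evaluated once
    for both branches. *)
Lemma ev_ifnum env (c : bool) e1 e2 x1 x2 T1 T2 :
  ev env e1 (VNum x1) T1 -> ev env e2 (VNum x2) T2 ->
  ev env (if c then e1 else e2) (VNum (if c then x1 else x2)) (T1 + T2).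
Proof.
case: c => h1 h2; first by apply: ev_weaken h1 _ _; rewrite ?leq_addr.
by apply: ev_weaken h2 _ _; rewrite ?leq_addl.
Qed.

Lemma ev_call env f e v v' w T1 T2 :
  runs f v' w T2 -> ev env e v T1 -> v = v' ->
  ev env (Call f e) w (T1 + T2).+1.
Proof.
move=> [body hb [t2 l2 h2]] [t1 l1 h1] ev; rewrite ev in h1.
by exists (t1 + t2).+1; [rewrite ltnS leq_add | apply: EvCall h1 hb h2].
Qed.

Lemma ev_tl env e h t T : ev env e (VCons h t) T -> ev env (tl e) t (T + 1).+1.
Proof. by move=> he; apply: ev_match_cons he _; apply: ev_var. Qed.

Lemma ev_hd env e h t T : ev env e (VCons h t) T -> ev env (hd e) h (T + 1).+1.
Proof. by move=> he; apply: ev_match_cons he _; apply: ev_var. Qed.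

Lemma ev_tls env i x vs : onth env x = Some (enc_list vs) ->
  (i <= size vs)%N ->
  ev env (iter i tl (Var x)) (enc_list (drop i vs)) (2 * i + 1).
Proof.
move=> hx; elim: i => [|i IHi] lt_i /=.
  by rewrite drop0; apply: ev_var.
have := IHi (ltnW lt_i); rewrite (drop_nth VNil lt_i) /= => /ev_tl h.
by apply: ev_weaken h _ _ => //; rewrite mulnS; lia.
Qed.

Lemma ev_arg env i x vs v :
  onth env x = Some (enc_list vs) -> onth vs i = Some v ->
  ev env (arg i x) v (2 * i + 3).
Proof.
move=> hx hi; have lt_i : (i < size vs)%N.
  by rewrite ltnNge; apply/negP => /onth_default; rewrite hi.
have := ev_tls hx (ltnW lt_i); rewrite (drop_nth VNil lt_i) /= => /ev_hd h.
apply: ev_weaken h _ _; last by lia.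
by move: hi; rewrite onthE (nth_map VNil) // => -[].
Qed.

End Bounded.

Lemma natS (m : nat) : m.+1%:R - 1 = m%:R :> rat.
Proof. by rewrite -addn1 natrD addrK. Qed.
Lemma natP (m : nat) : m%:R + 1 = m.+1%:R :> rat.
Proof. by rewrite -addn1 natrD. Qed.
Lemma nat_le0 (m : nat) : (m.+1%:R <= 0 :> rat) = false.
Proof. by rewrite lern0. Qed.

(** [steps] evaluates an expression symbolically, leaving calls, matches and
    conditionals to the user; [call] proves a call from the lemma about the
    function called. *)
Ltac steps :=
  lazymatch goal with
  | |- ev _ _ (arg _ _) _ _ => eapply ev_arg; reflexivity
  | |- ev _ _ (tl _) _ _ => eapply ev_tl; steps
  | |- ev _ _ (hd _) _ _ => eapply ev_hd; steps
  | |- ev _ _ (Var _) _ _ => eapply ev_var; reflexivity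
  | |- ev _ _ (Cst _) _ _ => eapply ev_cst
  | |- ev _ _ ENil _ _ => eapply ev_nil
  | |- ev _ _ (args (?e :: ?es)) _ _ =>
      change (args (e :: es)) with (ECons e (args es)); steps
  | |- ev _ _ (args [::]) _ _ => change (args [::]) with ENil; steps
  | |- ev _ _ (Op OpDiv _ _) _ _ => eapply ev_div; [steps | steps | ]
  | |- ev _ _ (Op _ _ _) _ _ => eapply ev_op; [steps | steps | reflexivity]
  | |- ev _ _ (ECons _ _) _ _ => eapply ev_cons; [steps | steps]
  | |- ev _ _ (Let _ _) _ _ => eapply ev_let; [steps | steps]
  | |- ev _ _ (IfEq _ _ _ _) _ _ => eapply ev_ifeq; [steps | steps | ]
  | |- ev _ _ (IfLe _ _ _ _) _ _ => eapply ev_ifle; [steps | steps | ]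
  | |- _ => idtac
  end.

Ltac enter := eexists; [reflexivity | ].
Ltac call H := eapply ev_call; [eapply H | steps | ].

(** * The program *)

Notation qrow := (seq rat).
Notation qmat := (seq (seq rat)).

Notation "'c0'" := (Cst 0). Notation "'c1'" := (Cst 1).
Infix "|+|" := (Op OpAdd) (at level 50, left associativity).
Infix "|-|" := (Op OpSub) (at level 50, left associativity).
Infix "|*|" := (Op OpMul) (at level 40, left associativity).
Infix "|/|" := (Op OpDiv) (at level 40, left associativity).
Notation "f @! es" := (Call f (args es)) (at level 30, es at level 0).
Notation "'#' i" := (Var i) (at level 1, format "# i").

(** Positions of the functions in [prog]. *)
Definition f_pow := 1%N.
Definition f_sum := 2%N.
Definition f_prodsum := 3%N.
Definition f_prod_row := 4%N.
Definition f_prod_mat := 5%N.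
Definition f_power_sum := 6%N.
Definition f_power_loop := 7%N.
Definition f_nth := 8%N.
Definition f_entry_prod := 9%N.
Definition f_cp_entry := 10%N.
Definition f_corr := 11%N.
Definition f_potential := 12%N.
Definition f_keep := 13%N.
Definition f_revapp := 14%N.
Definition f_search := 15%N.
Definition f_greedy_index := 16%N.
Definition f_weight_row := 17%N.
Definition f_weight_mat := 18%N.
Definition f_addrow := 19%N.
Definition f_addat := 20%N.
Definition f_residual_mat := 21%N.
Definition f_eqidx := 22%N.
Definition f_add_entry := 23%N.
Definition f_scale := 24%N.
Definition f_iter := 25%N.
Definition f_mincap := 26%N.
Definition f_pour := 27%N.
Definition f_pourall := 28%N.
Definition f_firstpos := 29%N.
Definition f_firstidx := 30%N.
Definition f_fill_corners := 31%N.
Definition f_init := 32%N.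
Definition f_final := 33%N.
Definition f_ceil := 34%N.

(** The list in front of a body names the components of its argument. *)

(* [x; m] *)
Definition body_pow :=
  IfLe (arg 1 0) c0 c1 (arg 0 0 |*| f_pow @! [:: arg 0 0; arg 1 0 |-| c1]).

Definition body_sum := Match #0 c0 (#0 |+| Call f_sum #1).

Definition body_prodsum := Match #0 c1 (Call f_sum #0 |*| Call f_prodsum #1).

(* [r1; r2] *)
Definition body_prod_row :=
  Match (arg 0 0) ENil (Match (arg 1 2) ENil
    (ECons (#2 |*| #0) (f_prod_row @! [:: #3; #1]))).

(* [V; U] *)
Definition body_prod_mat :=
  Match (arg 0 0) ENil (Match (arg 1 2) ENil
    (ECons (f_prod_row @! [:: #2; #0]) (f_prod_mat @! [:: #3; #1]))).

(* [Us; m; N; V] *)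
Definition body_power_sum :=
  Match (arg 0 0)
    (f_pow @! [:: arg 2 0; arg 1 0] |*| Call f_prodsum (arg 3 0))
    (f_power_loop @! [:: #0; #1; arg 1 2; c0; arg 2 2; arg 3 2]).

(* [U; Us; m; d; N; V] *)
Definition body_power_loop :=
  f_power_sum @! [:: arg 1 0; arg 2 0; arg 4 0; arg 5 0] |+|
  IfLe (arg 2 0) c0 c0
    (arg 2 0 |/| (arg 3 0 |+| c1) |*|
     f_power_loop @! [:: arg 0 0; arg 1 0; arg 2 0 |-| c1; arg 3 0 |+| c1; arg 4 0;
                   f_prod_mat @! [:: arg 5 0; arg 0 0]]).

(* [r; a] *)
Definition body_nth :=
  Match (arg 0 0) c0
    (IfLe (arg 1 2) c0 #0 (f_nth @! [:: #1; arg 1 2 |-| c1])).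

(* [V; j] *)
Definition body_entry_prod :=
  Match (arg 0 0) c1 (Match (arg 1 2) c1
    (f_nth @! [:: #2; #0] |*| f_entry_prod @! [:: #3; #1])).

(* [Us; j] *)
Definition body_cp_entry :=
  Match (arg 0 0) c0
    (f_entry_prod @! [:: #0; arg 1 2] |+| f_cp_entry @! [:: #1; arg 1 2]).

(* [A; V; Us; D; N] *)
Definition body_corr :=
  Match (arg 0 0) c0
    (Let (arg 4 2 |+| f_cp_entry @! [:: arg 2 2; hd #0])
       (f_entry_prod @! [:: arg 1 3; hd #1] |*|
          (f_pow @! [:: #0 |+| (hd (tl #1) |-| tl (tl #1)); arg 3 3] |-|
           f_pow @! [:: #0; arg 3 3]) |+|
        f_corr @! [:: #2; arg 1 3; arg 2 3; arg 3 3; arg 4 3])).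

(* [V; Us; D; N; A] *)
Definition body_potential :=
  f_power_sum @! [:: arg 1 0; arg 2 0; arg 3 0; arg 0 0] |+|
  f_corr @! [:: arg 4 0; arg 0 0; arg 1 0; arg 2 0; arg 3 0].

(* [r; a] *)
Definition body_keep :=
  Match (arg 0 0) ENil
    (ECons (IfEq (arg 1 2) c0 #0 c0) (f_keep @! [:: #1; arg 1 2 |-| c1])).

(* [V; W] *)
Definition body_revapp :=
  Match (arg 0 0) (arg 1 0) (f_revapp @! [:: #1; ECons #0 (arg 1 2)]).

(* [a; t; n; pre; r; rest; ctx] *)
Definition body_search :=
  IfLe (arg 0 0) c0 c0
    (IfLe (arg 1 0)
       (arg 2 0 |*| Call f_potential (ECons
          (f_revapp @! [:: arg 3 0;
             ECons (f_keep @! [:: arg 4 0; arg 0 0]) (arg 5 0)]) (arg 6 0)))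
       (arg 0 0)
       (f_search @! [:: arg 0 0 |-| c1; arg 1 0; arg 2 0; arg 3 0; arg 4 0;
                       arg 5 0; arg 6 0])).

(* [pre; rest; n; ctx] *)
Definition body_greedy_index :=
  Match (arg 1 0) ENil
    (Let (f_search @! [:: arg 2 2 |-| c1;
            Call f_potential (ECons (f_revapp @! [:: arg 0 2; arg 1 2]) (arg 3 2));
            arg 2 2; arg 0 2; #0; #1; arg 3 2])
       (ECons #0 (f_greedy_index @! [:: ECons (f_keep @! [:: #1; #0]) (arg 0 3);
                                 #2; arg 2 3; arg 3 3]))).

(* [r; lam; N; D] *)
Definition body_weight_row :=
  Match (arg 0 0) ENil
    (ECons (f_pow @! [:: arg 2 2 |+| arg 1 2 |*| #0; arg 3 2])
       (f_weight_row @! [:: #1; arg 1 2; arg 2 2; arg 3 2])).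

(* [V; lam; N; D] *)
Definition body_weight_mat :=
  Match (arg 0 0) ENil
    (ECons (f_weight_row @! [:: #0; arg 1 2; arg 2 2; arg 3 2])
       (f_weight_mat @! [:: #1; arg 1 2; arg 2 2; arg 3 2])).

(* [r; a; q] *)
Definition body_addrow :=
  Match (arg 0 0) ENil
    (ECons (IfEq (arg 1 2) c0 (#0 |+| arg 2 2) #0)
       (f_addrow @! [:: #1; arg 1 2 |-| c1; arg 2 2])).

(* [C; j; q] *)
Definition body_addat :=
  Match (arg 0 0) ENil (Match (arg 1 2) ENil
    (ECons (f_addrow @! [:: #2; #0; arg 2 4])
       (f_addat @! [:: #3; #1; arg 2 4]))).

(* [A; C] *)
Definition body_residual_mat :=
  Match (arg 0 0) (arg 1 0)
    (f_residual_mat @! [:: #1; f_addat @! [:: arg 1 2; hd #0; c0 |-| tl (tl #0)]]).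

(* [j; j'] *)
Definition body_eqidx :=
  Match (arg 0 0) c1 (Match (arg 1 2) c0
    (IfEq #2 #0 (f_eqidx @! [:: #3; #1]) c0)).

(* [j; q; A] *)
Definition body_add_entry :=
  Match (arg 2 0) (ECons (ECons (arg 0 0) (ECons c0 (arg 1 0))) ENil)
    (IfLe c1 (f_eqidx @! [:: hd #0; arg 0 2])
       (ECons (ECons (hd #0) (ECons (hd (tl #0)) (tl (tl #0) |+| arg 1 2))) #1)
       (ECons #0 (f_add_entry @! [:: arg 0 2; arg 1 2; #1]))).

(* [g; A] *)
Definition body_scale :=
  Match (arg 1 0) ENil
    (ECons (ECons (hd #0) (ECons (hd (tl #0)) (arg 0 2 |*| tl (tl #0))))
       (f_scale @! [:: arg 0 2; #1])).

(* [m; g; A; Us; D; N; lam; n; mu] *)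
Definition body_iter :=
  IfLe (arg 0 0) c0 (arg 2 0)
    (f_iter @! [:: arg 0 0 |-| c1; arg 1 0;
       f_add_entry @! [::
         f_greedy_index @! [:: ENil;
           f_weight_mat @! [:: f_residual_mat @! [:: arg 2 0; arg 8 0];
                        arg 6 0; arg 5 0; arg 4 0];
           arg 7 0;
           args [:: arg 3 0; arg 4 0; arg 5 0; arg 2 0]];
         arg 1 0;
         f_scale @! [:: c1 |-| arg 1 0; arg 2 0]];
       arg 3 0; arg 4 0; arg 5 0; arg 6 0; arg 7 0; arg 8 0]).

(* [C; j; q] *)
Definition body_mincap :=
  Match (arg 0 0) (arg 2 0) (Match (arg 1 2) (arg 2 2)
    (Let (f_nth @! [:: #2; #0])
      (f_mincap @! [:: #4; #2; IfLe (arg 2 5) #0 (arg 2 5) #0]))).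

(* [j; q; C; Out] *)
Definition body_pour :=
  Let (f_mincap @! [:: arg 2 0; arg 0 0; arg 1 0])
    (IfLe #0 c0 (ECons (arg 2 1) (arg 3 1))
       (ECons (f_addat @! [:: arg 2 1; arg 0 1; c0 |-| #0])
          (f_add_entry @! [:: arg 0 1; #0; arg 3 1]))).

(* [A; C; Out] *)
Definition body_pourall :=
  Match (arg 0 0) (ECons (arg 1 0) (arg 2 0))
    (Let (f_pour @! [:: hd #0; tl (tl #0); arg 1 2; arg 2 2])
       (f_pourall @! [:: #2; hd #0; tl #0])).

Definition body_firstpos :=
  Match #0 c0
    (IfLe #0 c0 (Match #1 c0 (c1 |+| Call f_firstpos #3)) c0).

Definition body_firstidx :=
  Match #0 ENil (ECons (Call f_firstpos #0) (Call f_firstidx #1)).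

(* [m; C; Out] *)
Definition body_fill_corners :=
  IfLe (arg 0 0) c0 (arg 2 0)
    (Let (f_pour @! [:: Call f_firstidx (arg 1 0); c1; arg 1 0; arg 2 0])
       (f_fill_corners @! [:: arg 0 1 |-| c1; hd #0; tl #0])).

Definition body_init :=
  Match #0 ENil
    (ECons (ECons (hd #0) (ECons (tl #0) c0)) (Call f_init #1)).

Definition body_final :=
  Match #0 ENil
    (ECons (ECons (hd #0) (tl (tl #0))) (Call f_final #1)).

(* [m; eps] *)
Definition body_ceil :=
  IfLe (arg 0 0 |*| arg 1 0) c1 (f_ceil @! [:: arg 0 0 |+| c1; arg 1 0])
    (arg 0 0).

(* [n; k; U; S; mu; eps].  The bindings are in this order [accuracy], [penalty],
   [range], [shift] and [inv_step], then the Frank-Wolfe table and the result of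
   pouring it. *)
Definition body_main (b : nat) :=
  Let (f_ceil @! [:: c0; arg 5 0])
  (Let (Cst (9 * (2 + 4 * b) ^ 2)%:R |*| (arg 0 1 |*| arg 1 1 |*| #0))
  (Let (Cst (2 * b + 1)%:R |+| #0 |*| arg 1 2)
  (Let (Cst 32 |*| (#0 |*| #0 |*| #2))
  (Let (Cst 4 |*| #3 |*| (Cst (4 * b + 2)%:R |+| Cst 3 |*| (#2 |*| arg 1 4)))
  (Let (f_iter @! [:: #0 |*| #0; c1 |/| #0; Call f_init (arg 3 5); arg 2 5;
         arg 1 5 |*| arg 0 5 |*| (Cst 32 |*| #1 |*| #4); #1; #3; arg 0 5; arg 4 5])
  (Let (f_pourall @! [:: #0; arg 4 6; ENil])
  (Call f_final (f_fill_corners @! [:: arg 0 7 |*| arg 1 7; hd #0; tl #0])))))))).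

Definition prog (b : nat) : program :=
  [:: body_main b; body_pow; body_sum; body_prodsum; body_prod_row;
      body_prod_mat; body_power_sum; body_power_loop; body_nth;
      body_entry_prod; body_cp_entry; body_corr; body_potential; body_keep;
      body_revapp; body_search; body_greedy_index; body_weight_row;
      body_weight_mat; body_addrow; body_addat; body_residual_mat; body_eqidx;
      body_add_entry; body_scale; body_iter; body_mincap; body_pour;
      body_pourall; body_firstpos; body_firstidx; body_fill_corners; body_init;
      body_final; body_ceil].

(** * The functions that the program computes *)

Arguments enc_list : simpl never.

Definition enc_row (r : qrow) := enc_list (map VNum r).
Definition enc_mat (V : qmat) := enc_list (map enc_row V).
Definition enc_mats (Us : seq qmat) := enc_list (map enc_mat Us).
Definition enc_nats (s : seq nat) := enc_list (map enc_nat s).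

Definition sumr (r : qrow) : rat := \sum_(x <- r) x.
Definition prodsum (V : qmat) : rat := \prod_(r <- V) sumr r.
Definition prod_row (r1 r2 : qrow) : qrow := [seq z.1 * z.2 | z <- zip r1 r2].
Definition prod_mat (V U : qmat) : qmat := [seq prod_row z.1 z.2 | z <- zip V U].

(** Horner form of the binomial expansion: with [m + d] constant along the
    recursion, the factors [m / (d + 1)] multiply up to binomial coefficients. *)
Fixpoint power_loop (g : nat -> qmat -> rat) (U : qmat) (m d : nat) (V : qmat) : rat :=
  g m V + if m is m'.+1 then
            m%:R / (d%:R + 1) * power_loop g U m' d.+1 (prod_mat V U) else 0.

(** The sum over all multi-indices j of V(j) (N + sum_U U(j))^m, where V and the
    U are rank-one tensors given by their factors ([power_sumE]). *)
Fixpoint power_sum (N : rat) (Us : seq qmat) (m : nat) (V : qmat) : rat :=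
  if Us is U :: Us' then power_loop (power_sum N Us') U m 0 V else N ^+ m * prodsum V.

Definition entry_prod (V : qmat) (j : seq nat) : rat :=
  \prod_(z <- zip V j) nth 0 z.1 z.2.
Definition cp_entry (Us : seq qmat) (j : seq nat) : rat := \sum_(U <- Us) entry_prod U j.

(** The position is a rational that runs below zero after the position is
    passed, as the counters of the program do. *)
Fixpoint keep (r : qrow) (a : rat) : qrow :=
  if r is x :: r' then (if a == 0 then x else 0) :: keep r' (a - 1) else [::].

Fixpoint addrow (r : qrow) (a q : rat) : qrow :=
  if r is x :: r' then (if a == 0 then x + q else x) :: addrow r' (a - 1) q
  else [::].

Definition addat (C : qmat) (j : seq nat) (q : rat) : qmat :=
  [seq addrow z.1 z.2%:R q | z <- zip C j].

Definition weight_row lam N D (r : qrow) : qrow := [seq (N + lam * x) ^+ D | x <- r].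
Definition weight_mat lam N D (V : qmat) : qmat := map (weight_row lam N D) V.

Definition mincap (C : qmat) (j : seq nat) (q : rat) : rat :=
  foldl (fun q z => if q <= nth 0 z.1 z.2 then q else nth 0 z.1 z.2) q (zip C j).

(** The last position is returned if no entry is positive, so that the result
    is always a valid index. *)
Fixpoint firstpos (r : qrow) : nat :=
  if r is x :: r' then
    if x <= 0 then if r' is [::] then 0 else (firstpos r').+1 else 0
  else 0.

Section Table.
Variables n k : nat.
Notation idx := (multi_index n.+1 k).
(** A table holds the sparse tensors S and P together, so that each multi-index
    of their joint support occurs once. *)
Definition table := seq (idx * (rat * rat)).

Definition nats (j : idx) : seq nat := [seq val a | a <- j].
Definition enc_entry (e : idx * (rat * rat)) : value :=
  VCons (enc_index e.1) (VCons (VNum e.2.1) (VNum e.2.2)).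
Definition enc_table (A : table) := enc_list (map enc_entry A).

Definition corr (A : table) (V : qmat) (Us : seq qmat) (D : nat) (N : rat) : rat :=
  \sum_(e <- A) entry_prod V (nats e.1) *
    ((N + cp_entry Us (nats e.1) + (e.2.1 - e.2.2)) ^+ D
     - (N + cp_entry Us (nats e.1)) ^+ D).

(** The low-rank part is summed over all multi-indices and then corrected at the
    multi-indices of the table. *)
Definition potential (Us : seq qmat) (D : nat) (N : rat) (A : table) (V : qmat) : rat :=
  power_sum N Us D V + corr A V Us D N.

(** When [t] is the value before the split, some position passes the test by
    averaging, so position 0 need not be tested once all the others failed. *)
Fixpoint search (f : qmat -> rat) (t : rat) (pre : qmat) (r : qrow)
    (rest : qmat) (a : nat) : nat :=
  if a is a'.+1 then
    if t <= n.+1%:R * f (catrev pre (keep r a%:R :: rest)) then a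
    else search f t pre r rest a'
  else 0.

Fixpoint greedy_index (f : qmat -> rat) (pre rest : qmat) : seq nat :=
  if rest is r :: rest' then
    let a := search f (f (catrev pre rest)) pre r rest' n in
    a :: greedy_index f (keep r a%:R :: pre) rest'
  else [::].

Definition toidx (s : seq nat) : idx := [tuple inord (nth 0 s i) | i < k].

Definition residual_mat (A : table) (C : qmat) : qmat :=
  foldl (fun C e => addat C (nats e.1) (- e.2.2)) C A.

Fixpoint add_entry (j : idx) (q : rat) (A : table) : table :=
  if A is e :: A' then
    if e.1 == j then (e.1, (e.2.1, e.2.2 + q)) :: A' else e :: add_entry j q A'
  else [:: (j, (0, q))].

Definition scale (g : rat) (A : table) : table :=
  [seq (e.1, (e.2.1, g * e.2.2)) | e <- A].

Definition fw_step (g : rat) Us D N lam mu (A : table) : table :=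
  let j := greedy_index (potential Us D N A) [::]
    (weight_mat lam N D (residual_mat A mu)) in
  add_entry (toidx j) g (scale (1 - g) A).

(** [CO] pairs the remaining capacities with the entries written so far.
    Nothing is written when nothing fits, which keeps all entries positive. *)
Definition pour (j : idx) (q : rat) (CO : qmat * table) : qmat * table :=
  let z := mincap CO.1 (nats j) q in
  if z <= 0 then CO else (addat CO.1 (nats j) (- z), add_entry j z CO.2).

Definition pourall (A : table) (CO : qmat * table) : qmat * table :=
  foldl (fun CO e => pour e.1 e.2.2 CO) CO A.

Definition firstidx (C : qmat) : idx := toidx (map firstpos C).

(** The amount 1 is never a restriction, as capacities are at most 1. *)
Definition fill_corners (m : nat) (CO : qmat * table) : qmat * table :=
  iter m (fun CO => pour (firstidx CO.1) 1 CO) CO.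

Definition init_table (s : seq (idx * rat)) : table :=
  [seq (e.1, (e.2, 0)) | e <- s].
Definition final_entries (A : table) : seq (idx * rat) :=
  [seq (e.1, e.2.2) | e <- A].

End Table.

Lemma size_keep r a : size (keep r a) = size r.
Proof. by elim: r a => [|x r IHr] a //=; rewrite IHr. Qed.

Lemma size_addrow r a q : size (addrow r a q) = size r.
Proof. by elim: r a => [|x r IHr] a //=; rewrite IHr. Qed.

Lemma search_le n f t pre r rest a : (search n f t pre r rest a <= a)%N.
Proof. by elim: a => //= a IHa; case: ifP => // _; apply: leqW. Qed.

Lemma size_greedy_index n f pre rest : size (greedy_index n f pre rest) = size rest.
Proof. by elim: rest pre => [|r rest IHr] pre //=; rewrite IHr. Qed.

Lemma greedy_index_lt n f pre rest : all (fun a => a < n.+1)%N (greedy_index n f pre rest).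
Proof.
by elim: rest pre => [|r rest IHr] pre //=; rewrite IHr ltnS search_le.
Qed.

Lemma firstpos_lt n r : size r = n.+1 -> (firstpos r < n.+1)%N.
Proof.
elim: r n => [|x r IHr] n //= [<-]; case: ifP => // _.
by case: r IHr => [|y r] //= IHr; rewrite ltnS; apply: IHr.
Qed.

Section Index.
Variables n k : nat.

Lemma enc_indexE (j : multi_index n.+1 k) : enc_index j = enc_nats (nats j).
Proof. by rewrite /enc_index /enc_nats /nats -map_comp. Qed.

Lemma size_nats (j : multi_index n.+1 k) : size (nats j) = k.
Proof. by rewrite size_map size_tuple. Qed.

Lemma nats_toidx s : size s = k -> all (fun a => a < n.+1)%N s ->
  nats (toidx n k s) = s.
Proof.
move=> hs hlt; apply: (@eq_from_nth _ 0%N); rewrite size_nats // => i hi.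
rewrite /nats /toidx (nth_map ord0) ?size_tuple //.
rewrite -[i]/(val (Ordinal hi)) -tnth_nth tnth_mktuple /= inordK //.
by apply: (allP hlt); rewrite mem_nth // hs.
Qed.

Lemma size_addat (C : qmat) (j : multi_index n.+1 k) q :
  size C = k -> size (addat C (nats j) q) = k.
Proof. by move=> hC; rewrite size_map size_zip hC size_nats minnn. Qed.

Lemma size_residual_mat (A : table n k) C : size C = k -> size (residual_mat A C) = k.
Proof.
rewrite /residual_mat; elim: A C => [|e A IHA] C //= hC; apply: IHA; exact: size_addat.
Qed.

Lemma size_add_entry j q (A : table n k) : (size (add_entry j q A) <= (size A).+1)%N.
Proof. by elim: A => [|e A IHA] //=; case: ifP. Qed.

End Index.

Lemma all_size_addat n C j q : all (fun r => size r == n.+1) C ->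
  all (fun r => size r == n.+1) (addat C j q).
Proof.
elim: C j => [|r C IHC] [|a j] //= /andP[hr hC].
by rewrite size_addrow hr; apply: IHC.
Qed.

Lemma size_pour n k j q CO :
  (size (@pour n k j q CO).2 <= (size CO.2).+1)%N.
Proof. by rewrite /pour; case: ifP => // _; apply: size_add_entry. Qed.

Definition mat_of (k n : nat) (f : 'I_k -> 'I_n -> rat) : qmat :=
  [seq [seq f i a | a <- enum 'I_n] | i <- enum 'I_k].
Definition mats_of (r k n : nat) (u : 'I_r -> 'I_k -> 'I_n -> rat) : seq qmat :=
  [seq mat_of (u l) | l <- enum 'I_r].

Lemma enc_mat_of k n (f : 'I_k -> 'I_n -> rat) :
  enc_fun (fun i => enc_fun (fun a => VNum (f i a))) = enc_mat (mat_of f).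
Proof.
rewrite /enc_fun /enc_mat /mat_of -map_comp; congr enc_list.
by apply: eq_map => i /=; rewrite /enc_row -map_comp.
Qed.

Lemma enc_mats_of r k n (u : 'I_r -> 'I_k -> 'I_n -> rat) :
  enc_fun (fun l => enc_fun (fun i => enc_fun (fun a => VNum (u l i a)))) =
  enc_mats (mats_of u).
Proof.
rewrite /enc_mats /mats_of -map_comp {1}/enc_fun; congr enc_list.
by apply: eq_map => l /=; rewrite enc_mat_of.
Qed.

Lemma size_mat_of k n (f : 'I_k -> 'I_n -> rat) : size (mat_of f) = k.
Proof. by rewrite size_map size_enum_ord. Qed.

Lemma all_size_mat_of k n (f : 'I_k -> 'I_n -> rat) :
  all (fun r => size r == n) (mat_of f).
Proof. by apply/allP => r /mapP[i _ ->]; rewrite size_map size_enum_ord. Qed.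

(** The least natural number above 1 / eps. *)
Definition accuracy (eps : rat) : nat := (Num.truncn eps^-1).+1.

(** [b] bounds the entries of R and of S.  The constants come from the error
    budget 3 / (4 * M): the penalty makes the loss of [rounded_cost] equal to
    1 / (4 * M); [range] bounds the sum of the sizes of the terms of a score; [shift]
    and [power] are those of [oracle_accuracy], and the inexact oracle costs
    another 1 / (4 * M); the same remains after [rounds] steps of length
    [1 / inv_step]. *)
Section Constants.
Variables b n k M : nat.
Definition penalty : nat := (9 * (2 + 4 * b) ^ 2 * (n * k * M))%N.
Definition range : nat := (2 * b + 1 + penalty * k)%N.
Definition shift : nat := (32 * (range * range * M))%N.
Definition power : nat := (k * n * (32 * shift * M))%N.
Definition inv_step : nat := (4 * M * (4 * b + 2 + 3 * (penalty * k)))%N.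
Definition rounds : nat := (inv_step * inv_step)%N.
End Constants.

Section Solution.
Variables (b n k M : nat) (Us : seq qmat) (mu : qmat)
  (S : seq (multi_index n.+1 k * rat)).
Let N := (shift b n.+1 k M)%:R : rat.
Let lam := (penalty b n.+1 k M)%:R : rat.
Definition fw_table : table n k :=
  iter (rounds b n.+1 k M)
    (fw_step (inv_step b n.+1 k M)%:R^-1 Us (power b n.+1 k M) N lam mu)
    (init_table S).
Definition solution : seq (multi_index n.+1 k * rat) :=
  final_entries (fill_corners (n.+1 * k) (pourall fw_table (mu, [::]))).2.

Lemma size_fw_table : (size fw_table <= rounds b n.+1 k M + size S)%N.
Proof.
rewrite /fw_table; elim: (rounds _ _ _ _) => [|m IHm] /=; first by rewrite size_map.
rewrite /fw_step; apply: leq_trans (size_add_entry _ _ _) _.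
by rewrite size_map addSn ltnS.
Qed.

Lemma size_pourall (A : table n k) CO :
  (size (pourall A CO).2 <= size A + size CO.2)%N.
Proof.
rewrite /pourall; elim: A CO => //= e A IHA CO.
by apply: leq_trans (IHA _) _; rewrite addSnnS leq_add2l size_pour.
Qed.

Lemma size_fill_corners m (CO : qmat * table n k) :
  (size (fill_corners m CO).2 <= m + size CO.2)%N.
Proof.
rewrite /fill_corners; elim: m => //= m IHm.
by apply: leq_trans (size_pour _ _ _) _; rewrite addSn ltnS.
Qed.

Lemma size_solution :
  (size solution <= n.+1 * k + (rounds b n.+1 k M + size S))%N.
Proof.
rewrite size_map; apply: leq_trans (size_fill_corners _ _) _; rewrite leq_add2l.
by apply: leq_trans (size_pourall _ _) _; rewrite addn0 size_fw_table.
Qed.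
End Solution.

(** * The functions and the tensors they stand for *)

Definition coef (V : qmat) (i a : nat) : rat := nth 0 (nth [::] V i) a.

Lemma entry_prod_cons r V a s : entry_prod (r :: V) (a :: s) = nth 0 r a * entry_prod V s.
Proof. by rewrite /entry_prod /= big_cons. Qed.

Lemma entry_prod_cat V1 V2 s1 s2 : size V1 = size s1 ->
  entry_prod (V1 ++ V2) (s1 ++ s2) = entry_prod V1 s1 * entry_prod V2 s2.
Proof. by move=> h; rewrite /entry_prod zip_cat // big_cat. Qed.

Lemma nth_prod_row r r' a : nth 0 (prod_row r r') a = nth 0 r a * nth 0 r' a.
Proof.
elim: r r' a => [|x r IHr] [|y r'] [|a] //=; rewrite ?nth_nil ?mul0r ?mulr0 //.
exact: IHr.
Qed.

Lemma entry_prod_prod_mat V U s : size V = size U ->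
  entry_prod (prod_mat V U) s = entry_prod V s * entry_prod U s.
Proof.
elim: V U s => [|r V IHV] [|u U] [|a s] //= hs;
  rewrite ?/entry_prod ?big_nil ?mulr1 //.
case: hs => hs; rewrite -!/(entry_prod _ _) !entry_prod_cons nth_prod_row IHV //.
by rewrite mulrACA.
Qed.

Lemma nth_keep r (q : rat) b : nth 0 (keep r q) b = if q == b%:R then nth 0 r b else 0.
Proof.
elim: r q b => [|x r IHr] q [|b] /=; rewrite ?nth_nil ?if_same //.
by rewrite IHr subr_eq natP.
Qed.

Lemma nth_addrow r (q z : rat) b : (b < size r)%N ->
  nth 0 (addrow r q z) b = nth 0 r b + (if q == b%:R then z else 0).
Proof.
elim: r q b => [|x r IHr] q [|b] //= hb; first by case: eqP; rewrite ?addr0.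
by rewrite IHr // subr_eq natP.
Qed.

Definition keepall (V : qmat) (s : seq nat) : qmat :=
  [seq keep z.1 z.2%:R | z <- zip V s].

Lemma entry_prod_keepall V s t : size V = size s -> size V = size t ->
  entry_prod (keepall V s) t = if s == t then entry_prod V t else 0.
Proof.
elim: V s t => [|r V IHV] [|a s] [|c t] // [hs] [ht].
rewrite -[keepall _ _]/(keep r a%:R :: keepall V s) !entry_prod_cons IHV //.
rewrite nth_keep eqr_nat eqseq_cons.
by case: eqP => _ /=; rewrite ?mul0r //; case: eqP => _; rewrite ?mulr0.
Qed.

Section Shape.
Variables n k : nat.
Notation idx := (multi_index n.+1 k).

Definition shaped (V : qmat) := (size V == k) && all (fun r : qrow => size r == n.+1) V.

Lemma shaped_size V : shaped V -> size V = k. Proof. by case/andP => /eqP. Qed.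

Lemma shaped_row V i : shaped V -> (i < k)%N -> size (nth [::] V i) = n.+1.
Proof.
case/andP=> /eqP hk /allP h hi; apply/eqP; apply: (h (nth [::] V i)).
by apply: mem_nth; rewrite hk.
Qed.

Lemma nth_nats (j : idx) (i : 'I_k) : nth 0%N (nats j) i = tnth j i.
Proof.
rewrite (nth_map ord0) ?size_tuple //; congr (val _).
by rewrite (tnth_nth ord0).
Qed.

Lemma natsK (j : idx) : toidx n k (nats j) = j.
Proof.
by apply: eq_from_tnth => i; rewrite tnth_mktuple nth_nats inord_val.
Qed.

Lemma nats_inj : injective (@nats n k).
Proof. by apply: can_inj natsK. Qed.

Lemma entry_prodE V (j : idx) : size V = k ->
  entry_prod V (nats j) = \prod_(i < k) coef V i (tnth j i).
Proof.
move=> hV; rewrite /entry_prod (big_nth ([::], 0%N)) big_mkord size_zip hV size_nats minnn.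
apply: eq_bigr => i _; rewrite nth_zip ?size_nats //= nth_nats.
by [].
Qed.

(** Distributivity: choosing a multi-index is choosing an entry in each row. *)
Lemma sum_entry_prod V : shaped V -> \sum_(j : idx) entry_prod V (nats j) = prodsum V.
Proof.
move=> hV; have hk := shaped_size hV.
under eq_bigr do rewrite entry_prodE //.
have -> : prodsum V = \prod_(i < k) \sum_(a < n.+1) coef V i a.
  rewrite /prodsum (big_nth [::]) big_mkord hk; apply: eq_bigr => i _.
  by rewrite /sumr (big_nth 0) big_mkord (shaped_row hV).
rewrite bigA_distr_bigA /=.
rewrite (reindex (fun j : idx => [ffun i => tnth j i])) /=; last first.
  exists (fun f : {ffun 'I_k -> 'I_n.+1} => [tuple f i | i < k]) => j _.
    by apply: eq_from_tnth => i; rewrite tnth_mktuple ffunE.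
  by apply/ffunP => i; rewrite ffunE tnth_mktuple.
by apply: eq_bigr => j _; apply: eq_bigr => i _; rewrite ffunE.
Qed.

Lemma shaped_prod_mat V U : shaped V -> shaped U -> shaped (prod_mat V U).
Proof.
case/andP=> /eqP hV rV /andP[/eqP hU rU]; apply/andP; split.
  by rewrite size_map size_zip hV hU minnn.
elim: V U rV rU {hV hU} => [|r V IHV] [|u U] //= /andP[/eqP hr rV] /andP[/eqP hu rU].
by rewrite size_map size_zip hr hu minnn eqxx IHV.
Qed.

(** [power_loop] at a single multi-index. *)
Fixpoint scalar_loop (m d : nat) (u y : rat) : rat :=
  y ^+ m + if m is m'.+1 then m%:R / (d%:R + 1) * (u * scalar_loop m' d.+1 u y) else 0.

Lemma scalar_loopE m d u y : scalar_loop m d u y =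
  \sum_(e < m.+1) (m ^_ e)%:R * (d`!)%:R / ((d + e)`!)%:R * u ^+ e * y ^+ (m - e).
Proof.
elim: m d => [|m IHm] d.
  by rewrite big_ord1 /= addn0 ffactn0 mul1r divff ?pnatr_eq0 -?lt0n ?fact_gt0 //.
rewrite big_ord_recl /= IHm ffactn0 mul1r subn0 addn0 divff ?pnatr_eq0 -?lt0n ?fact_gt0 //.
rewrite expr0 !mul1r; congr (_ + _); rewrite !mulr_sumr; apply: eq_bigr => e _.
rewrite /bump /= add1n subSS ffactSS addnS -addSn natrM factS natrM natP exprS.
have h1 : d.+1%:R != 0 :> rat by rewrite pnatr_eq0.
by field; rewrite addrC natP h1 pnatr_eq0 -lt0n fact_gt0.
Qed.

Lemma scalar_loop0 m u y : scalar_loop m 0 u y = (y + u) ^+ m.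
Proof.
rewrite scalar_loopE exprDn; apply: eq_bigr => e _.
rewrite add0n fact0 mulr1 -bin_ffact natrM mulfK ?pnatr_eq0 -?lt0n ?fact_gt0 //.
by rewrite -mulrA -[RHS]mulr_natl; congr (_ * _); rewrite mulrC.
Qed.

Lemma power_sumE N Us m V : all shaped Us -> shaped V ->
  power_sum N Us m V = \sum_(j : idx) entry_prod V (nats j) * (N + cp_entry Us (nats j)) ^+ m.
Proof.
elim: Us m V => [|U Us IHUs] m V /=.
  move=> _ hV; rewrite -sum_entry_prod // mulr_sumr; apply: eq_bigr => j _.
  by rewrite /cp_entry big_nil addr0 mulrC.
case/andP=> hU hUs hV.
suff H d : power_loop (power_sum N Us) U m d V = \sum_(j : idx) entry_prod V (nats j) *
    scalar_loop m d (entry_prod U (nats j)) (N + cp_entry Us (nats j)).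
  rewrite H; apply: eq_bigr => j _; rewrite scalar_loop0 /cp_entry big_cons.
  by rewrite -addrA [_ + entry_prod _ _]addrC.
elim: m d V hV => [|m IHm] d V hV /=.
  by rewrite IHUs // addr0; apply: eq_bigr => j _; rewrite addr0.
rewrite IHUs // IHm ?shaped_prod_mat // mulr_sumr -big_split /=.
apply: eq_bigr => j _; rewrite entry_prod_prod_mat ?(shaped_size hV) ?(shaped_size hU) //.
by ring.
Qed.

Definition table_S (A : table n k) : tensor rat n.+1 k :=
  fun j => \sum_(e <- A | e.1 == j) e.2.1.
Definition table_P (A : table n k) : tensor rat n.+1 k :=
  fun j => \sum_(e <- A | e.1 == j) e.2.2.
Definition keys (A : table n k) := [seq e.1 | e <- A].

(** With distinct keys each multi-index is corrected once; off the keys the two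
    sparse tensors vanish, and so does [h]. *)
Lemma sum_table (A : table n k) (h : idx -> rat -> rat) :
  uniq (keys A) -> (forall j, h j 0 = 0) ->
  \sum_(e <- A) h e.1 (e.2.1 - e.2.2) = \sum_j h j (table_S A j - table_P A j).
Proof.
move=> uA h0; elim: A uA => [|e A IHA] /=.
  by rewrite big_nil big1 // => j _; rewrite /table_S /table_P !big_nil subrr.
case/andP=> he uA; rewrite big_cons IHA // [RHS](bigD1 e.1) //= [in LHS](bigD1 e.1) //=.
have z (f : idx * (rat * rat) -> rat) : \sum_(e' <- A | e'.1 == e.1) f e' = 0.
  rewrite big_seq_cond big1 // => e' /andP[he' /eqP ee].
  by case/negP: he; rewrite -ee; apply: map_f.
rewrite /table_S /table_P !big_cons eqxx !z subrr h0 add0r !addr0; congr (_ + _).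
by apply: eq_bigr => j hj; rewrite !big_cons eq_sym (negbTE hj).
Qed.

Lemma potentialE Us D N A V : uniq (keys A) -> all shaped Us -> shaped V ->
  potential Us D N A V = \sum_(j : idx) entry_prod V (nats j) *
    (N + cp_entry Us (nats j) + (table_S A j - table_P A j)) ^+ D.
Proof.
move=> uA hUs hV; rewrite /potential power_sumE //.
rewrite /corr (@sum_table A (fun j x => entry_prod V (nats j) *
  ((N + cp_entry Us (nats j) + x) ^+ D - (N + cp_entry Us (nats j)) ^+ D))) //.
  by rewrite -big_split /=; apply: eq_bigr => j _; ring.
by move=> j; rewrite addr0 subrr mulr0.
Qed.

Section Select.
Variable g : idx -> rat.
Let f V : rat := \sum_(j : idx) entry_prod V (nats j) * g j.

Lemma f_split pre r rest : (size pre + (size rest).+1 = k)%N ->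
  f (catrev pre (r :: rest)) =
  \sum_(a < n.+1) f (catrev pre (keep r a%:R :: rest)).
Proof.
move=> hk; rewrite /f exchange_big /=; apply: eq_bigr => j _.
rewrite -mulr_suml; congr (_ * _); rewrite catrevE.
have hj : size (nats j) = k := size_nats j.
have lt_k : (size pre < size (nats j))%N by rewrite hj -hk addnS ltnS leq_addr.
rewrite -(cat_take_drop (size pre) (nats j)) (drop_nth 0%N lt_k).
have hs : size (rev pre) = size (take (size pre) (nats j)).
  by rewrite size_rev size_take lt_k.
rewrite entry_prod_cat // entry_prod_cons.
have lt_n : (nth 0%N (nats j) (size pre) < n.+1)%N.
  have hp : (size pre < k)%N by rewrite -hj.
  by rewrite -[size pre]/(val (Ordinal hp)) nth_nats.
rewrite (bigD1 (Ordinal lt_n)) //= catrevE entry_prod_cat // entry_prod_cons nth_keep eqxx.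
rewrite big1 ?addr0 // => a ha; rewrite catrevE entry_prod_cat // entry_prod_cons nth_keep.
rewrite eqr_nat; case: eqP => [e|_]; last by rewrite mul0r mulr0.
by case/negP: ha; apply/eqP/val_inj.
Qed.

(** If the position found fails the test, then the search has run down to 0 and
    every position fails it. *)
Lemma search_lt t pre r rest m :
  n.+1%:R * f (catrev pre (keep r (search n f t pre r rest m)%:R :: rest)) < t ->
  forall a, (a <= m)%N -> n.+1%:R * f (catrev pre (keep r a%:R :: rest)) < t.
Proof.
elim: m => [|m IHm] h a; first by move: h; rewrite leqn0 => h /eqP ->.
move: h => /=; case: ifP => [le|/negbT gt]; first by rewrite ltNge le.
move=> h; rewrite leq_eqVlt => /orP[/eqP ->|]; last by rewrite ltnS; apply: IHm.
by rewrite ltNge.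
Qed.

(** The n parts into which fixing a coordinate splits the sum cannot all be
    below the average. *)
Lemma search_spec pre r rest : (size pre + (size rest).+1 = k)%N ->
  f (catrev pre (r :: rest)) <= n.+1%:R * f (catrev pre
    (keep r (search n f (f (catrev pre (r :: rest))) pre r rest n)%:R :: rest)).
Proof.
move=> hk; set t := f (catrev pre _); rewrite leNgt; apply/negP => /search_lt H.
have : \sum_(a < n.+1) n.+1%:R * f (catrev pre (keep r a%:R :: rest)) <
    \sum_(a < n.+1) t.
  apply: ltr_sum => [|a _]; last by apply: H; rewrite -ltnS.
  by apply/hasP; exists ord0; rewrite // mem_index_enum.
by rewrite -mulr_sumr -f_split // sumr_const card_ord mulr_natl ltxx.
Qed.

Lemma greedy_index_spec pre rest : (size pre + size rest = k)%N ->
  f (catrev pre rest) <=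
  n.+1%:R ^+ size rest * f (catrev pre (keepall rest (greedy_index n f pre rest))).
Proof.
elim: rest pre => [|r rest IHr] pre hk.
  by rewrite expr0 mul1r.
apply: le_trans (search_spec r hk) _.
set a := search _ _ _ _ _ _ _.
have -> : keepall (r :: rest) (greedy_index n f pre (r :: rest)) =
  keep r a%:R :: keepall rest (greedy_index n f (keep r a%:R :: pre) rest) by [].
rewrite /= exprS -mulrA ler_pM2l ?ltr0n //.
by apply: (IHr (keep r a%:R :: pre)); rewrite /= addSnnS.
Qed.

(** Once all coordinates are fixed a single term of the sum is left. *)
Lemma greedy_index_max V j' : shaped V ->
  (forall j : idx, 0 <= entry_prod V (nats j)) -> (forall j, 0 <= g j) ->
  entry_prod V (nats j') * g j' <= n.+1%:R ^+ k *
    (entry_prod V (nats (toidx n k (greedy_index n f [::] V))) *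
     g (toidx n k (greedy_index n f [::] V))).
Proof.
move=> hV V0 g0; set j := toidx _ _ _; have hk := shaped_size hV.
apply: (@le_trans _ _ (f V)).
  rewrite /f (bigD1 j') //= lerDl; apply: sumr_ge0 => i _; exact: mulr_ge0.
have := @greedy_index_spec [::] V hk; rewrite /= hk => h; apply: le_trans h _.
rewrite ler_pM2l ?exprn_gt0 ?ltr0n // /f (bigD1 j) //=.
have hs : size V = size (greedy_index n f [::] V) by rewrite size_greedy_index.
have hj : nats j = greedy_index n f [::] V.
  by apply: nats_toidx; rewrite ?greedy_index_lt ?size_greedy_index.
rewrite entry_prod_keepall ?hj ?eqxx // big1 ?addr0 // => i hi.
rewrite entry_prod_keepall // ?size_nats // -hj; case: eqP => [e|_]; last by rewrite mul0r.
by case/negP: hi; apply/eqP/nats_inj.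
Qed.
End Select.

(** capacity matrices *)
Lemma nth_addat C (j : idx) q i : size C = k -> (i < k)%N ->
  nth [::] (addat C (nats j) q) i = addrow (nth [::] C i) (nth 0%N (nats j) i)%:R q.
Proof.
move=> hC hi; rewrite (nth_map ([::], 0%N)) ?nth_zip //= ?size_nats //.
by rewrite size_zip hC size_nats minnn.
Qed.

Lemma coef_addat C (j : idx) q (i : 'I_k) (a : 'I_n.+1) : shaped C ->
  coef (addat C (nats j) q) i a = coef C i a + q * (tnth j i == a)%:R.
Proof.
move=> hC; rewrite /coef nth_addat ?(shaped_size hC) // nth_addrow.
  by rewrite nth_nats eqr_nat -val_eqE /=; case: eqP; rewrite ?mulr1 ?mulr0.
by rewrite (shaped_row hC).
Qed.

Lemma shaped_addat C (j : idx) q : shaped C -> shaped (addat C (nats j) q).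
Proof.
case/andP=> /eqP h1 h2; apply/andP; split; first by rewrite size_addat.
exact: all_size_addat.
Qed.

Lemma shaped_residual_mat (A : table n k) C : shaped C -> shaped (residual_mat A C).
Proof.
rewrite /residual_mat; elim: A C => [|e A IHA] C //= hC; apply: IHA; exact: shaped_addat.
Qed.

Lemma table_P_cons e A j : table_P (e :: A) j = e.2.2 * point rat e.1 j + table_P A j.
Proof.
rewrite /table_P big_cons /point eq_sym; case: eqP => _; rewrite ?mulr1 //.
by rewrite mulr0 add0r.
Qed.

Lemma marginal_table_cons e A i a : marginal (table_P (e :: A)) i a =
  e.2.2 * (tnth e.1 i == a)%:R + marginal (table_P A) i a.
Proof.
rewrite -marginal_point /marginal mulr_sumr -big_split /=.
by apply: eq_bigr => j _; apply: table_P_cons.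
Qed.

Lemma marginal_nil i a : marginal (table_P [::]) i a = 0.
Proof. by rewrite /marginal big1 // => j _; rewrite /table_P big_nil. Qed.

Lemma coef_residual_mat (A : table n k) C (i : 'I_k) (a : 'I_n.+1) : shaped C ->
  coef (residual_mat A C) i a = coef C i a - marginal (table_P A) i a.
Proof.
rewrite /residual_mat; elim: A C => [|e A IHA] C /= hC; first by rewrite marginal_nil subr0.
rewrite IHA ?shaped_addat // coef_addat // marginal_table_cons.
by rewrite opprD addrA mulNr.
Qed.

Lemma table_P_add_entry j q A j' : table_P (add_entry j q A) j' = table_P A j' + q * point rat j j'.
Proof.
elim: A => [|e A IHA] /=; first by rewrite table_P_cons addrC.
case: eqP => [ej|_]; rewrite !table_P_cons /= ?IHA ?ej; ring.
Qed.

Lemma table_S_add_entry j q A j' : table_S (add_entry j q A) j' = table_S A j'.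
Proof.
elim: A => [|e A IHA] /=; first by rewrite /table_S big_cons big_nil if_same ?addr0.
case: eqP => [_|_]; rewrite /table_S !big_cons //=.
by rewrite -!/(table_S _ _) IHA.
Qed.

Lemma keys_add_entry j q A :
  keys (add_entry j q A) = if j \in keys A then keys A else rcons (keys A) j.
Proof.
elim: A => [|e A IHA] //=; rewrite inE eq_sym; case: eqP => [//|_] /=.
by rewrite IHA; case: ifP.
Qed.

Lemma uniq_add_entry j q A : uniq (keys A) -> uniq (keys (add_entry j q A)).
Proof. by move=> h; rewrite keys_add_entry; case: ifP => // hj; rewrite rcons_uniq hj. Qed.

Lemma keys_scale c A : keys (scale c A) = keys A.
Proof. by rewrite /keys -map_comp. Qed.

Lemma table_P_scale c A j : table_P (scale c A) j = c * table_P A j.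
Proof. by rewrite /table_P big_map mulr_sumr. Qed.

Lemma table_S_scale c A j : table_S (scale c A) j = table_S A j.
Proof. by rewrite /table_S big_map. Qed.

Lemma nth_weight_mat lam N D V (i : 'I_k) (a : 'I_n.+1) : shaped V ->
  coef (weight_mat lam N D V) i a = (N + lam * coef V i a) ^+ D.
Proof.
move=> hV; rewrite /coef (nth_map [::]) ?(shaped_size hV) //.
by rewrite (nth_map 0) // (shaped_row hV).
Qed.

Lemma shaped_weight_mat lam N D V : shaped V -> shaped (weight_mat lam N D V).
Proof.
case/andP=> h1 h2; apply/andP; split; first by rewrite size_map.
by rewrite all_map; apply: sub_all h2 => r /=; rewrite size_map.
Qed.

Lemma shaped_mat_of (f : 'I_k -> 'I_n.+1 -> rat) : shaped (mat_of f).
Proof. by rewrite /shaped size_mat_of eqxx all_size_mat_of. Qed.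

Lemma coef_mat_of (f : 'I_k -> 'I_n.+1 -> rat) (i : 'I_k) (a : 'I_n.+1) :
  coef (mat_of f) i a = f i a.
Proof.
rewrite /coef (nth_map i) ?size_enum_ord // (nth_map a) ?size_enum_ord //.
by rewrite !nth_ord_enum.
Qed.

Lemma cp_entry_mats_of r (u : 'I_r -> 'I_k -> 'I_n.+1 -> rat) (j : idx) :
  cp_entry (mats_of u) (nats j) = factored u j.
Proof.
rewrite /cp_entry big_map big_enum /=; apply: eq_bigr => l _.
rewrite entry_prodE ?size_mat_of //; apply: eq_bigr => i _; exact: coef_mat_of.
Qed.
End Shape.

(** * Rounding to the transport polytope *)

Lemma mincap_spec C s q :
  [/\ mincap C s q <= q,
      forall i, (i < size C)%N -> (i < size s)%N -> mincap C s q <= coef C i (nth 0%N s i) &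
      mincap C s q = q \/
      exists i, [/\ (i < size C)%N, (i < size s)%N & mincap C s q = coef C i (nth 0%N s i)]].
Proof.
elim: C s q => [|r C IHC] [|a s] q; try by split => //; left.
rewrite -[mincap _ _ _]/(mincap C s (if q <= nth 0 r a then q else nth 0 r a)).
set q' := if _ then _ else _; have [h1 h2 h3] := IHC s q'.
have hq : q' <= q /\ q' <= nth 0 r a.
  by rewrite /q'; case: (leP q (nth 0 r a)) => h; split => //; apply: ltW.
split; first by apply: le_trans h1 _; case: hq.
  move=> [|i] /=; first by move=> _ _; apply: le_trans h1 _; case: hq.
  by rewrite !ltnS => hi hs; apply: h2.
case: h3 => [->|[i [hi hs e]]]; last by right; exists i.+1.
by rewrite /q'; case: (leP q (nth 0 r a)) => _; [left | right; exists 0%N].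
Qed.

Lemma firstpos_gt0 r : has (fun x => 0 < x) r -> 0 < nth 0 r (firstpos r).
Proof.
elim: r => [|x [|y r] IHr] //=; first by case: leP.
by case: (leP x 0) => // _; apply: IHr.
Qed.

Section Rounding.
Variables n k : nat.
Notation idx := (multi_index n.+1 k).
Notation pair := (qmat * table n k)%type.
Hypothesis k0 : (0 < k)%N.

Definition nonneg (C : qmat) := forall (i : 'I_k) (a : 'I_n.+1), 0 <= coef C i a.

Definition good_table (O : table n k) := uniq (keys O) && all (fun e => 0 < e.2.2) O.

Lemma good_add_entry j z O : 0 < z -> good_table O -> good_table (add_entry j z O).
Proof.
move=> z0 /andP[hu hp]; rewrite /good_table uniq_add_entry //=.
elim: O hp {hu} => [|e O IHO] /=; first by rewrite z0.
case/andP=> he hO; case: eqP => _ /=; first by rewrite addr_gt0.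
by rewrite he IHO.
Qed.

Lemma pour_good j q CO : good_table CO.2 -> good_table (@pour n k j q CO).2.
Proof. by rewrite /pour; case: leP => // h; apply: good_add_entry. Qed.

Lemma pour_shaped j q CO : shaped n k CO.1 -> shaped n k (@pour n k j q CO).1.
Proof. by rewrite /pour; case: leP => // _; apply: shaped_addat. Qed.

(** An amount smaller than asked for exhausts some capacity. *)
Lemma pour_spec j q (CO : pair) : shaped n k CO.1 -> nonneg CO.1 -> 0 <= q ->
  exists z, [/\ 0 <= z <= q,
    forall (i : 'I_k) (a : 'I_n.+1), coef (pour j q CO).1 i a =
      coef CO.1 i a - z * (tnth j i == a)%:R,
    forall j', table_P (pour j q CO).2 j' = table_P CO.2 j' + z * point rat j j',
    nonneg (pour j q CO).1 &
    z = q \/ exists i : 'I_k, coef (pour j q CO).1 i (tnth j i) = 0].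
Proof.
move=> hC C0 q0; have [h1 h2 h3] := mincap_spec CO.1 (nats j) q.
have sC := shaped_size hC; have sj := size_nats j.
have hle (i : 'I_k) : mincap CO.1 (nats j) q <= coef CO.1 i (tnth j i).
  by have := h2 i; rewrite sC sj nth_nats => /(_ (ltn_ord i) (ltn_ord i)).
have z0 : 0 <= mincap CO.1 (nats j) q.
  case: h3 => [->//|[i [hi _ ->]]]; rewrite sC in hi.
  by rewrite -[i]/(val (Ordinal hi)) nth_nats; apply: C0.
have zz : mincap CO.1 (nats j) q <= 0 -> mincap CO.1 (nats j) q = 0.
  by move=> h; apply: le_anti; rewrite h.
have hcoef (i : 'I_k) (a : 'I_n.+1) : coef (pour j q CO).1 i a =
    coef CO.1 i a - mincap CO.1 (nats j) q * (tnth j i == a)%:R.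
  rewrite /pour; case: leP => hz /=; last by rewrite coef_addat // mulNr.
  by rewrite (zz hz) mul0r subr0.
exists (mincap CO.1 (nats j) q); split => //.
- by rewrite z0.
- move=> j'; rewrite /pour; case: leP => hz /=; last by rewrite table_P_add_entry.
  by rewrite (zz hz) mul0r addr0.
- move=> i a; rewrite hcoef subr_ge0.
  by case: eqP => [<-|_]; rewrite ?mulr1 ?mulr0.
- case: h3 => [|[i [hi _ e]]]; [by left|right]; rewrite sC in hi.
  exists (Ordinal hi); rewrite hcoef eqxx mulr1 e.
  by rewrite -[i]/(val (Ordinal hi)) nth_nats subrr.
Qed.

Lemma pourall_good A CO : good_table CO.2 -> good_table (@pourall n k A CO).2.
Proof.
rewrite /pourall; elim: A CO => //= e A IHA CO h; apply: IHA; exact: pour_good.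
Qed.

Lemma pourall_shaped A CO : shaped n k CO.1 -> shaped n k (@pourall n k A CO).1.
Proof.
rewrite /pourall; elim: A CO => //= e A IHA CO h; apply: IHA; exact: pour_shaped.
Qed.

(** When an entry is cut, the part cut off is charged to a capacity (i, a) that
    is then exhausted.  What the table has later in the slice (i, a) is cut
    too, so the total charge to (i, a) is at most the excess of the marginal
    over the capacity. *)
Lemma pourall_spec (A : table n k) (CO : pair) :
  shaped n k CO.1 -> nonneg CO.1 -> all (fun e => 0 <= e.2.2) A ->
  exists W : tensor rat n.+1 k, [/\
    (forall j, 0 <= W j <= table_P A j) /\ nonneg (pourall A CO).1,
    forall (i : 'I_k) (a : 'I_n.+1), coef (pourall A CO).1 i a = coef CO.1 i a - marginal W i a,
    forall j, table_P (pourall A CO).2 j = table_P CO.2 j + W j &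
    \sum_j (table_P A j - W j) <=
      \sum_i \sum_a Num.max 0 (marginal (table_P A) i a - coef CO.1 i a)].
Proof.
elim: A CO => [|e A IHA] CO hC C0 /=.
  exists (fun _ => 0); split => //.
  - by split=> // j; rewrite /table_P big_nil lexx.
  - by move=> i a; rewrite /marginal big1 // subr0.
  - by move=> j; rewrite addr0.
  rewrite big1 => [|j _]; last by rewrite /table_P big_nil subrr.
  by apply: sumr_ge0 => i _; apply: sumr_ge0 => a _; rewrite le_max lexx.
case/andP=> e0 A0.
have [z [/andP[z0 zq] hc hp C0' hz]] := pour_spec e.1 hC C0 e0.
have hC' := @pour_shaped e.1 e.2.2 CO hC.
have [W [[W0 Cn] hc' hp' hsum]] := IHA _ hC' C0' A0.
rewrite -[pourall _ _]/(pourall A (pour e.1 e.2.2 CO)).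
have p0 j : 0 <= point rat e.1 j <= 1 by rewrite /point; case: eqP; rewrite ?ler01 ?lexx.
exists (fun j => W j + z * point rat e.1 j).
have hm (i : 'I_k) (a : 'I_n.+1) : marginal (fun j => W j + z * point rat e.1 j) i a =
    marginal W i a + z * (tnth e.1 i == a)%:R.
  by rewrite marginal_lin marginal_point.
split.
- split=> // j; rewrite table_P_cons; have /andP[w0 w1] := W0 j.
  have /andP[q0 q1] := p0 j; apply/andP; split; first by rewrite addr_ge0 ?mulr_ge0.
  by rewrite [leRHS]addrC lerD // ler_wpM2r.
- by move=> i a; rewrite hc' hc hm opprD addrA addrAC.
- by move=> j; rewrite hp' hp -addrA [W j + _]addrC.
have -> : \sum_j (table_P (e :: A) j - (W j + z * point rat e.1 j)) =
    (e.2.2 - z) + \sum_j (table_P A j - W j).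
  have -> : e.2.2 - z = \sum_j point rat e.1 j * (e.2.2 - z).
    by rewrite (@sum_point _ _ _ (fun _ => e.2.2 - z)).
  by rewrite -big_split /=; apply: eq_bigr => j _; rewrite table_P_cons; ring.
apply: le_trans (lerD (lexx _) hsum) _.
set t := e.2.2 - z; have t0 : 0 <= t by rewrite subr_ge0.
set y := fun (i : 'I_k) (a : 'I_n.+1) => marginal (table_P A) i a - coef (pour e.1 e.2.2 CO).1 i a.
have hy (i : 'I_k) (a : 'I_n.+1) : marginal (table_P (e :: A)) i a - coef CO.1 i a =
    y i a + t * (tnth e.1 i == a)%:R.
  by rewrite /y hc marginal_table_cons /t; ring.
have mono (i : 'I_k) (a : 'I_n.+1) : Num.max 0 (y i a) <=
    Num.max 0 (marginal (table_P (e :: A)) i a - coef CO.1 i a).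
  rewrite hy ge_max !le_max lexx /=; apply/orP; right.
  by rewrite lerDl mulr_ge0.
case: hz => [ez|[i0 hi0]].
  rewrite /t ez subrr add0r.
  by apply: ler_sum => i _; apply: ler_sum => a _; apply: mono.
rewrite (bigD1 i0) //= [leRHS](bigD1 i0) //= addrA lerD //; last first.
  by apply: ler_sum => i _; apply: ler_sum => a _; apply: mono.
rewrite (bigD1 (tnth e.1 i0)) //= [leRHS](bigD1 (tnth e.1 i0)) //= addrA lerD //; last first.
  by apply: ler_sum => a _; apply: mono.
have y0 : 0 <= y i0 (tnth e.1 i0).
  by rewrite /y hi0 subr0 marginal_ge0 // => j; have /andP[/le_trans] := W0 j; apply.
by rewrite hy eqxx mulr1 addrC !max_r // addr_ge0.
Qed.

Definition support (C : qmat) : {set 'I_k * 'I_n.+1} :=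
  [set ia : 'I_k * 'I_n.+1 | 0 < coef C ia.1 ia.2].

(** As the rows of capacities have equal sums, while one is nonzero all have a
    positive entry; pouring at such entries exhausts one of them and shrinks
    the support. *)
Lemma fill_corners_spec m (CO : pair) (w : rat) :
  shaped n k CO.1 -> nonneg CO.1 -> (forall (i : 'I_k) (a : 'I_n.+1), coef CO.1 i a <= 1) ->
  (forall i : 'I_k, \sum_(a < n.+1) coef CO.1 i a = w) -> (#|support CO.1| <= m)%N ->
  exists W : tensor rat n.+1 k, [/\ forall j, 0 <= W j,
    forall (i : 'I_k) (a : 'I_n.+1), marginal W i a = coef CO.1 i a &
    forall j, table_P (fill_corners m CO).2 j = table_P CO.2 j + W j].
Proof.
elim: m CO w => [|m IHm] CO w hC C0 C1 hw hm.
  exists (fun _ => 0); split => //; last by move=> j; rewrite addr0.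
  move=> i a; rewrite /marginal big1 //; apply: le_anti; rewrite C0 /= leNgt.
  apply/negP => h; move: hm; rewrite leqn0 cards_eq0 => /eqP hs.
  have : (i, a) \in support CO.1 by rewrite inE.
  by rewrite hs inE.
set j := firstidx n k CO.1.
have [z [/andP[z0 z1] hc hp C0' hz]] := pour_spec j hC C0 ler01.
set CO' := pour j 1 CO in hc hp C0' hz.
have hC' : shaped n k CO'.1 by apply: pour_shaped.
have le_c (i : 'I_k) (a : 'I_n.+1) : coef CO'.1 i a <= coef CO.1 i a.
  by rewrite hc gerBl mulr_ge0.
have hw' (i : 'I_k) : \sum_(a < n.+1) coef CO'.1 i a = w - z.
  under eq_bigr do rewrite hc.
  rewrite sumrB hw -mulr_sumr (bigD1 (tnth j i)) //= eqxx big1 ?addr0 ?mulr1 //.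
  by move=> a; rewrite eq_sym => /negbTE ->.
have sub : support CO'.1 \subset support CO.1.
  by apply/subsetP => ia; rewrite !inE => h; apply: lt_le_trans h (le_c _ _).
have hm' : (#|support CO'.1| <= m)%N.
  case: (posnP #|support CO.1|) => [h0|hpos].
    by apply: leq_trans (subset_leq_card sub) _; rewrite h0.
  rewrite -ltnS; apply: leq_trans hm; apply: proper_card.
  have w0 : 0 < w.
    move: hpos; rewrite card_gt0 => /set0Pn[[i a]]; rewrite inE /= => h.
    rewrite -(hw i) (bigD1 a) //= ltr_pwDl // sumr_ge0 // => a' _; exact: C0.
  have pos (i : 'I_k) : 0 < coef CO.1 i (tnth j i).
    have sr := shaped_row hC (ltn_ord i).
    have -> : coef CO.1 i (tnth j i) = nth 0 (nth [::] CO.1 i) (firstpos (nth [::] CO.1 i)).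
      rewrite /coef /j /firstidx tnth_mktuple (nth_map [::]) ?(shaped_size hC) //.
      by rewrite inordK // firstpos_lt.
    apply: firstpos_gt0; apply/negbNE/negP => /hasPn h.
    move: w0; rewrite -(hw i) ltNge sumr_le0 // => a _.
    by rewrite leNgt; apply: h; rewrite mem_nth // sr.
  have [i hi] : exists i : 'I_k, coef CO'.1 i (tnth j i) = 0.
    case: hz => [ez|//]; exists (Ordinal k0); apply: le_anti; rewrite C0' andbT.
    by rewrite hc eqxx mulr1 ez subr_le0 C1.
  apply/properP; split=> //; exists (i, tnth j i); first by rewrite inE pos.
  by rewrite inE hi ltxx.
have [W [W0 hW hPW]] := IHm CO' _ hC' C0' (fun i a => le_trans (le_c i a) (C1 i a)) hw' hm'.
exists (fun j' => W j' + z * point rat j j'); split.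
- by move=> j'; rewrite addr_ge0 // mulr_ge0 // /point; case: eqP.
- by move=> i a; rewrite marginal_lin marginal_point hW hc subrK.
- by move=> j'; rewrite /fill_corners iterSr -/(fill_corners m _) hPW hp -addrA [W j' + _]addrC.
Qed.

Lemma fill_corners_good m CO : good_table CO.2 -> good_table (@fill_corners n k m CO).2.
Proof. by rewrite /fill_corners; elim: m => //= m IHm h; apply: pour_good; apply: IHm. Qed.

(** The mass cut off and the mass missing from P are both at most the total
    residual, and the second phase adds back their sum. *)
Lemma rounding_spec (A : table n k) (mu : 'I_k -> 'I_n.+1 -> rat) :
  (forall i, in_simplex (mu i)) -> all (fun e => 0 <= e.2.2) A ->
  let O := (fill_corners (n.+1 * k) (pourall A (mat_of mu, [::]))).2 in
  [/\ good_table O, transport_polytope mu (table_P O) &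
    \sum_j `|table_P O j - table_P A j| <=
     3 * \sum_i \sum_a `|residual mu (table_P A) i a| ].
Proof.
move=> hmu A0 O.
have hC := @shaped_mat_of n k mu.
have C0 : nonneg (mat_of mu) by move=> i a; rewrite coef_mat_of; case: (hmu i) => h _; apply: h.
have [W [[W0 Cn] hc hp hsum]] := @pourall_spec A (mat_of mu, [::]) hC C0 A0.
set CO := pourall A (mat_of mu, [::]) in Cn hc hp.
have hC' : shaped n k CO.1 by apply: pourall_shaped.
have Wn j : 0 <= W j by have /andP[] := W0 j.
have [W2 [W20 hW2 hp2]] : exists W2 : tensor rat n.+1 k, [/\ forall j, 0 <= W2 j,
    forall (i : 'I_k) (a : 'I_n.+1), marginal W2 i a = coef CO.1 i a &
    forall j, table_P O j = table_P CO.2 j + W2 j].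
  apply: (@fill_corners_spec _ CO (1 - \sum_j W j)) => //.
  - move=> i a; rewrite hc coef_mat_of.
    have [h0 h1] := hmu i.
    have : mu i a <= 1 by rewrite -h1 (bigD1 a) //= lerDl sumr_ge0.
    by have := @marginal_ge0 _ _ _ W i a Wn; lra.
  - move=> i; under eq_bigr do rewrite hc coef_mat_of.
    by rewrite sumrB sum_marginal; case: (hmu i) => _ ->.
  - apply: leq_trans (max_card _) _.
    by rewrite card_prod !card_ord mulnC.
have hO j : table_P O j = W j + W2 j.
  by rewrite hp2 hp /table_P big_nil add0r.
split.
- by apply: fill_corners_good; apply: pourall_good.
- split; first by move=> j; rewrite hO addr_ge0.
  move=> i a; rewrite /marginal; under eq_bigr do rewrite hO.
  by rewrite big_split /= -!/(marginal _ _ _) hW2 hc coef_mat_of addrC subrK.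
set X := \sum_i _.
have hX : \sum_j (table_P A j - W j) <= X.
  apply: le_trans hsum _; apply: ler_sum => i _; apply: ler_sum => a _.
  rewrite coef_mat_of ge_max normr_ge0 /= -normrN opprB; exact: ler_norm.
have sW2 : \sum_j W2 j = 1 - \sum_j W j.
  rewrite -(sum_marginal W2 (Ordinal k0)).
  under eq_bigr do rewrite hW2 hc coef_mat_of.
  by rewrite sumrB sum_marginal; case: (hmu (Ordinal k0)) => _ ->.
have hmass : 1 - \sum_j table_P A j <= X.
  have [_ <-] := hmu (Ordinal k0).
  rewrite -(sum_marginal _ (Ordinal k0)) -sumrB /X (bigD1 (Ordinal k0)) //=.
  rewrite -[leLHS]addr0 lerD //.
    by apply: ler_sum => a _; apply: ler_norm.
  by apply: sumr_ge0 => i _; apply: sumr_ge0.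
apply: (@le_trans _ _ (\sum_j ((table_P A j - W j) + W2 j))).
  apply: ler_sum => j _; rewrite hO.
  have /andP[? ?] := W0 j; have := W20 j; rewrite ler_norml => ?.
  by apply/andP; split; lra.
rewrite big_split /= sW2; move: hX; rewrite sumrB; lra.
Qed.

End Rounding.

(** * The output is nearly optimal *)

Lemma shaped_catrev_keep n k pre r rest (a : rat) :
  shaped n k (catrev pre (r :: rest)) -> shaped n k (catrev pre (keep r a :: rest)).
Proof.
by rewrite /shaped !catrevE !size_cat /= !all_cat /= size_keep.
Qed.

Lemma search_ext n k (f f' : qmat -> rat) t pre r rest a :
  (forall V, shaped n k V -> f V = f' V) -> shaped n k (catrev pre (r :: rest)) ->
  search n f t pre r rest a = search n f' t pre r rest a.
Proof.
move=> hf hV; elim: a => //= a ->.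
by rewrite hf //; apply: shaped_catrev_keep.
Qed.

(** [potential] agrees with the sum it stands for on matrices of the right shape
    only, which are the only ones met in the search. *)
Lemma greedy_index_ext n k (f f' : qmat -> rat) pre rest :
  (forall V, shaped n k V -> f V = f' V) -> shaped n k (catrev pre rest) ->
  greedy_index n f pre rest = greedy_index n f' pre rest.
Proof.
move=> hf; elim: rest pre => [|r rest IHr] pre hV //=.
rewrite hf // (@search_ext n k f f') // IHr //.
exact: (shaped_catrev_keep _ hV).
Qed.

Section Correct.
Variables (b n k r M : nat) (u : 'I_r -> 'I_k -> 'I_n.+1 -> rat)
  (mu : 'I_k -> 'I_n.+1 -> rat) (S : seq (multi_index n.+1 k * rat)).
Hypotheses (k0 : (0 < k)%N) (M0 : (0 < M)%N)
  (hmu : forall i, in_simplex (mu i)) (hS : entry_list S)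
  (hR1 : forall j, `|factored u j| <= b%:R)
  (hS1 : forall j, `|of_entries S j| <= b%:R).
Notation idx := (multi_index n.+1 k).

Let Q : tensor rat n.+1 k := fun j => factored u j + of_entries S j.
Let Us := mats_of u.
Let C0 := mat_of mu.
Let lam : rat := (penalty b n.+1 k M)%:R.
Let N : rat := (shift b n.+1 k M)%:R.
Let D := power b n.+1 k M.
Let s := inv_step b n.+1 k M.
Let g : rat := s%:R^-1.
Let step : table n k -> table n k := fw_step g Us D N lam C0.
Let iterate t : table n k := iter t step (init_table S).

Let penalty_gt0 : (0 < penalty b n.+1 k M)%N.
Proof. by rewrite /penalty !muln_gt0 k0 M0. Qed.
Let lam_gt0 : 0 < lam. Proof. by rewrite ltr0n. Qed.
Let range_gt0 : (0 < range b n.+1 k M)%N.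
Proof. by rewrite /range addn1 addSn. Qed.
Let s_gt0 : (0 < s)%N.
Proof. by rewrite /s /inv_step !muln_gt0 M0 addn2 addSn. Qed.
Let g01 : 0 <= g <= 1.
Proof. by rewrite invr_ge0 ler0n invf_le1 ?ltr0n // ler1n. Qed.

(** The invariant of the Frank-Wolfe iteration. *)
Definition sound (A : table n k) := [/\ uniq (keys A),
  forall j, table_S A j = of_entries S j, subdistribution (table_P A) &
  all (fun e => 0 <= e.2.2) A].

Lemma mu_le1 i a : 0 <= mu i a <= 1.
Proof.
have [h0 h1] := hmu i; rewrite h0 /= -h1 (bigD1 a) //= lerDl.
exact: sumr_ge0.
Qed.

Lemma residual_le1 (P : tensor rat n.+1 k) i a : subdistribution P -> `|residual mu P i a| <= 1.
Proof.
move=> hP; have /andP[m0 m1] := mu_le1 i a.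
have [P0 _] := hP; have := marginal_ge0 i a P0; have := marginal_le1 i a hP.
by rewrite /residual ler_norml => ? ?; apply/andP; split; lra.
Qed.

Definition chosen (A : table n k) : idx :=
  toidx n k (greedy_index n (potential Us D N A) [::] (weight_mat lam N D (residual_mat A C0))).

Lemma chosen_score A j' : sound A ->
  score lam mu Q (table_P A) j' <=
  score lam mu Q (table_P A) (chosen A) + (8 * M%:R)^-1.
Proof.
move=> [uA sA pA _]; have [P0 P1] := pA.
set y : idx -> rat := fun j => factored u j + (table_S A j - table_P A j).
set c : 'I_k -> 'I_n.+1 -> rat := fun i a => lam * residual mu (table_P A) i a.
have scoreE j : score lam mu Q (table_P A) j = y j + \sum_i c i (tnth j i).
  by rewrite /score /y /c -mulr_sumr sA /Q addrA.
have hLa j : `|y j| + \sum_i `|c i (tnth j i)| <= (range b n.+1 k M)%:R.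
  rewrite /range natrD; apply: lerD.
    have := hR1 j; have := hS1 j; have := P0 j; have := subdist_le1 j pA.
    rewrite /y sA !ler_norml natrD natrM => ? ? /andP[? ?] /andP[? ?].
    by apply/andP; split; lra.
  rewrite natrM -/lam; apply: sum_le_const => i.
  rewrite /c normrM gtr0_norm // -[leRHS]mulr1 ler_pM2l //; exact: residual_le1.
rewrite !scoreE; apply: (@oracle_accuracy _ _ _ y c (range b n.+1 k M) M) => //.
have La_gt0 := range_gt0; set La := range b n.+1 k M in hLa La_gt0 *.
have NLa : La%:R <= N.
  by rewrite ler_nat /shift -/La -mulnA mulnCA leq_pmulr // !muln_gt0 La_gt0.
have shift_ge0 x z : `|x| + z <= La%:R -> 0 <= z -> 0 <= N + x.
  move=> h hz; have : `|x| <= N by lra.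
  by rewrite ler_norml => /andP[? ?]; lra.
have y0 j : 0 <= N + y j by apply: shift_ge0 (hLa j) _; apply: sumr_ge0.
have c0 (j : idx) i : 0 <= N + c i (tnth j i).
  apply: (@shift_ge0 _ (`|y j| + \sum_(i' | i' != i) `|c i' (tnth j i')|)).
    by apply: le_trans (hLa j); rewrite [X in _ <= _ + X](bigD1 i) //= addrCA.
  by rewrite addr_ge0 ?sumr_ge0.
set V := weight_mat lam N D (residual_mat A C0).
have hC0 : shaped n k C0 by apply: shaped_mat_of.
have hV : shaped n k V by apply/shaped_weight_mat/shaped_residual_mat.
have prodV j : entry_prod V (nats j) = (\prod_i (N + c i (tnth j i))) ^+ D.
  rewrite entry_prodE ?(shaped_size hV) // -prodrXl; apply: eq_bigr => i _.
  by rewrite (@nth_weight_mat n k) ?shaped_residual_mat // coef_residual_mat // coef_mat_of.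
have bracketV j : bracket y c (range b n.+1 k M) M j ^+ D =
    entry_prod V (nats j) * (N + y j) ^+ D.
  by rewrite prodV mulrC -exprMn.
suff H : bracket y c (range b n.+1 k M) M j' ^+ D <=
    n.+1%:R ^+ k * bracket y c (range b n.+1 k M) M (chosen A) ^+ D by exact: H.
rewrite !bracketV.
have -> : chosen A = toidx n k (greedy_index n
    (fun V => \sum_(j : idx) entry_prod V (nats j) * (N + y j) ^+ D) [::] V).
  congr (toidx _ _ _); apply: (@greedy_index_ext n k) => // W hW.
  rewrite potentialE //; last by apply/allP => U /mapP[l _ ->]; apply: shaped_mat_of.
  by apply: eq_bigr => j _; rewrite cp_entry_mats_of /y -!addrA.
apply: (@greedy_index_max n k (fun j => (N + y j) ^+ D) V j') => //.
  by move=> j; rewrite prodV exprn_ge0 // prodr_ge0.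
by move=> j; rewrite exprn_ge0.
Qed.

Lemma step_table_P A j : table_P (step A) j =
  table_P A j + g * (point rat (chosen A) j - table_P A j).
Proof. by rewrite table_P_add_entry table_P_scale -/(chosen A); ring. Qed.

Lemma sum_step A : \sum_j table_P (step A) j = (1 - g) * \sum_j table_P A j + g.
Proof.
under eq_bigr do rewrite step_table_P.
have e : \sum_j point rat (chosen A) j = 1.
  rewrite -[RHS](@sum_point rat n.+1 k (fun _ => 1) (chosen A)).
  by apply: eq_bigr => ? _; rewrite mulr1.
by rewrite big_split /= -mulr_sumr sumrB e; ring.
Qed.

Lemma sound_step A : sound A -> sound (step A).
Proof.
move=> [uA sA [P0 P1] aA]; have /andP[g0 g1] := g01.
have g1' : 0 <= 1 - g by rewrite subr_ge0.
split.
- by apply: uniq_add_entry; rewrite keys_scale.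
- by move=> j; rewrite table_S_add_entry table_S_scale sA.
- split.
    move=> j; rewrite step_table_P.
    have -> : forall p q : rat, p + g * (q - p) = (1 - g) * p + g * q by move=> *; ring.
    by rewrite addr_ge0 ?mulr_ge0 // /point; case: eqP.
  by rewrite sum_step; nra.
- rewrite /step /fw_step; set j := toidx _ _ _.
  have : all (fun e => 0 <= e.2.2) (scale (1 - g) A).
    by rewrite all_map; apply: sub_all aA => e /= he; rewrite mulr_ge0.
  elim: (scale _ _) => [|e B IHB] /=; first by rewrite g0.
  case/andP=> he hB; case: eqP => _ /=; first by rewrite addr_ge0.
  by rewrite he IHB.
Qed.

Lemma table_P_init j : table_P (init_table S) j = 0.
Proof. by rewrite /table_P big_map big1. Qed.

Lemma sound_iterate t : sound (iterate t).
Proof.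
elim: t => [|t IHt]; last exact: sound_step.
split.
- by rewrite /keys -map_comp; case/andP: hS.
- by move=> j; rewrite /table_S big_map.
- by split=> [j|]; rewrite ?big1 ?table_P_init // => j _; rewrite table_P_init.
- by rewrite all_map; apply/allP => e _ /=.
Qed.

Section RealComparison.
Variable R : realType.
Variable Pstar : tensor R n.+1 k.
Let muR i a : R := ratr (mu i a).
Hypothesis hP : transport_polytope muR Pstar.
Let QR := to_real R Q.
Let real_iterate t := to_real R (table_P (iterate t)).
Let lamR : R := ratr lam.

Lemma ratr_marginal (P : tensor rat n.+1 k) i a :
  marginal (to_real R P) i a = ratr (marginal P i a).
Proof. by rewrite /marginal rmorph_sum. Qed.

Lemma ratr_residual (P : tensor rat n.+1 k) i a :
  residual muR (to_real R P) i a = ratr (residual mu P i a).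
Proof. by rewrite /residual rmorphB ratr_marginal. Qed.

Lemma ratr_sq_dist (P : tensor rat n.+1 k) :
  sq_dist (to_real R P) QR = ratr (sq_dist P Q).
Proof.
by rewrite /sq_dist rmorph_sum; apply: eq_bigr => j _; rewrite rmorphXn rmorphB.
Qed.

Lemma ratr_penalized (P : tensor rat n.+1 k) :
  penalized lamR muR QR (to_real R P) = ratr (penalized lam mu Q P).
Proof.
rewrite /penalized rmorphD rmorphM; congr (_ + _ * _); first exact: ratr_sq_dist.
rewrite rmorph_sum; apply: eq_bigr => i _; rewrite rmorph_sum; apply: eq_bigr => a _.
by rewrite rmorphXn ratr_residual.
Qed.

Lemma ratr_score (P : tensor rat n.+1 k) j :
  score lamR muR QR (to_real R P) j = ratr (score lam mu Q P j).
Proof.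
rewrite /score rmorphD rmorphB rmorphM rmorph_sum; congr (_ + _ * _).
by apply: eq_bigr => i _; rewrite ratr_residual.
Qed.

Lemma Pstar_mass : \sum_j Pstar j = 1.
Proof.
have [_ h] := hP; rewrite -(sum_marginal _ (Ordinal k0)).
under eq_bigr do rewrite h.
by rewrite -rmorph_sum; case: (hmu (Ordinal k0)) => _ ->; rewrite rmorph1.
Qed.

Let gap t := penalized lamR muR QR (real_iterate t) - sq_dist Pstar QR.

(** The competitor is real while the iterates are rational: the step inequality
    is applied to the images of the iterates. *)
Lemma gap_step t : gap t.+1 <= (1 - s%:R^-1) * gap t +
  s%:R^-1 * (2 * (8 * M%:R)^-1 + s%:R^-1 * (2 + 2 * lamR * k%:R)).
Proof.
have hA := sound_iterate t; have [_ _ [P0 P1] _] := hA.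
have -> : s%:R^-1 = ratr g :> R by rewrite /g fmorphV /= ratr_nat.
have hj := fun j' => @chosen_score (iterate t) j' hA.
set j := chosen (iterate t) in hj.
have -> : gap t.+1 = penalized lamR muR QR (fun j' => real_iterate t j' +
    ratr g * (point R j j' - real_iterate t j')) - sq_dist Pstar QR.
  congr (_ - _); rewrite /penalized; congr (_ + _ * _).
    apply: eq_bigr => j' _; congr ((_ - _) ^+ 2).
    rewrite /real_iterate /to_real [iterate _]/= step_table_P.
    by rewrite rmorphD rmorphM rmorphB /= /point ratr_nat.
  apply: eq_bigr => i _; apply: eq_bigr => a _; congr ((_ - _) ^+ 2).
  apply: eq_bigr => j' _.
  rewrite /real_iterate /to_real [iterate _]/= step_table_P.
  by rewrite rmorphD rmorphM rmorphB /= /point ratr_nat.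
apply: frank_wolfe_step => //.
- by rewrite ler0q ltW.
- by have /andP[h0 h1] := g01; rewrite ler0q h0 -(rmorph1 (@ratr R)) ler_rat.
- split=> [j'|]; first by rewrite /real_iterate /to_real ler0q.
  by rewrite /real_iterate /to_real -rmorph_sum -(rmorph1 (@ratr R)) ler_rat.
- move=> j'; rewrite !ratr_score -[M%:R](ratr_nat R) -[8](ratr_nat R).
  by rewrite -rmorphM -fmorphV -rmorphD ler_rat.
exact: Pstar_mass.
Qed.

Lemma Q_le j : `|Q j| <= 2 * b%:R.
Proof.
apply: le_trans (ler_normD _ _) _; have := hR1 j; have := hS1 j; lra.
Qed.

(** At the zero tensor the penalty is at most [lam * k], and the cost exceeds
    that of the competitor by at most twice the pairing of the competitor with
    Q. *)
Lemma gap0 : gap 0 <= 4 * b%:R + lamR * k%:R.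
Proof.
have [Ps0 _] := hP.
have P0 j : real_iterate 0 j = 0 by rewrite /real_iterate /to_real table_P_init rmorph0.
rewrite /gap /penalized addrAC; apply: lerD.
  rewrite /sq_dist -sumrB.
  apply: (@le_trans _ _ (\sum_j Pstar j * (4 * b%:R))); last first.
    by rewrite -mulr_suml Pstar_mass mul1r.
  apply: ler_sum => j _; rewrite P0.
  have : QR j <= 2 * b%:R.
    rewrite -[b%:R](ratr_nat R) -[2](ratr_nat R) -rmorphM ler_rat.
    exact: le_trans (ler_norm _) (Q_le j).
  have := Ps0 j; nra.
rewrite ler_pM2l ?ltr0q // -[leRHS]mul1r; apply: sum_le_const => i.
have [_ h1] := hmu i; rewrite -(rmorph1 (@ratr R)) -h1 rmorph_sum.
apply: ler_sum => a _.
have -> : residual muR (real_iterate 0) i a = muR i a.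
  by rewrite /residual /marginal big1 ?subr0.
rewrite -rmorphXn ler_rat; have /andP[h2 h3] := mu_le1 i a.
by rewrite expr2 ler_piMl.
Qed.

Lemma gap_final : gap (rounds b n.+1 k M) <= (2 * M%:R)^-1.
Proof.
have lamR0 : 0 <= lamR by rewrite ler0q ltW.
have sR : 0 < s%:R :> R by rewrite ltr0n.
have MR : 0 < M%:R :> R by rewrite ltr0n.
have s01 : (0 <= s%:R^-1 :> R) && (s%:R^-1 <= 1 :> R) by rewrite invr_ge0 ler0n invf_le1 // ler1n.
have hx : 0 <= lamR * k%:R by rewrite mulr_ge0.
have := @contraction R gap _ _ _ (rounds b n.+1 k M) s01 _ gap_step gap0.
have hd := @decay R s s_gt0.
have hb : 0 <= b%:R :> R by [].
have e0 : 0 <= 2 * (8 * M%:R)^-1 + s%:R^-1 * (2 + 2 * lamR * k%:R) :> R.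
  have h8 : 0 <= (8 * M%:R)^-1 :> R by rewrite invr_ge0 mulr_ge0 // ltW.
  have hs' : 0 <= s%:R^-1 :> R by rewrite invr_ge0 ltW.
  by apply: addr_ge0; apply: mulr_ge0 => //; lra.
move=> /(_ e0) h; apply: le_trans h _.
have K0 : 0 <= 4 * b%:R + lamR * k%:R by rewrite addr_ge0 // mulr_ge0.
have h1 : (1 - s%:R^-1) ^+ (rounds b n.+1 k M) * (4 * b%:R + lamR * k%:R) <=
    s%:R^-1 * (4 * b%:R + lamR * k%:R) by rewrite ler_wpM2r.
have sE : s%:R = 4 * M%:R * (4 * b%:R + 2 + 3 * (lamR * k%:R)) :> R.
  by rewrite /s /inv_step /lamR /lam ratr_nat !(natrM, natrD).
have h2 : s%:R^-1 * (4 * b%:R + 2 + 3 * (lamR * k%:R)) = (4 * M%:R)^-1.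
  rewrite sE; field; rewrite (gt_eqF MR) /= gt_eqF //; lra.
have h3 : 2 * (8 * M%:R)^-1 = (4 * M%:R)^-1 :> R by field; rewrite gt_eqF.
have h4 : (2 * M%:R)^-1 = (4 * M%:R)^-1 + (4 * M%:R)^-1 :> R by field; rewrite gt_eqF.
rewrite h4 h3 addrCA lerD2l -[leRHS]h2; apply: le_trans (lerD h1 (lexx _)) _.
rewrite -mulrDr ler_pM2l ?invr_gt0 //; lra.
Qed.

End RealComparison.

Let final := fw_table b M Us C0 S.
Let O := (fill_corners (n.+1 * k) (pourall final (C0, [::]))).2.

Lemma transport_le1 (P : tensor rat n.+1 k) j : transport_polytope mu P -> P j <= 1.
Proof.
move=> [P0 Pm]; apply: subdist_le1; split=> //.
rewrite -(sum_marginal _ (Ordinal k0)); under eq_bigr do rewrite Pm.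
by case: (hmu (Ordinal k0)) => _ ->.
Qed.

(** Each of the [n.+1 * k] residuals is paid by its penalty up to
    c^2 / (4 * lam), for c three times the Lipschitz constant; [penalty] is
    chosen to make the sum of these equal to 1 / (4 * M). *)
Lemma rounded_cost :
  sq_dist (table_P O) Q <= penalized lam mu Q (table_P final) + (4 * M%:R)^-1.
Proof.
have [_ _ pA aA] := sound_iterate (rounds b n.+1 k M).
rewrite -/final in pA aA; have [P0 _] := pA.
have [_ hO hdist] := rounding_spec k0 hmu aA; rewrite -/C0 -/O in hO hdist.
have [O0 _] := hO.
set L : rat := 2 + 4 * b%:R.
have L0 : 0 < L by rewrite /L ltr_wpDr // mulr_ge0.
have hL j : `|table_P final j + table_P O j - 2 * Q j| <= L.
  have := P0 j; have := O0 j; have := subdist_le1 j pA; have := transport_le1 j hO.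
  have := Q_le j; rewrite /L !ler_norml => /andP[? ?] ? ? ? ?.
  by apply/andP; split; lra.
apply: le_trans (sq_dist_lipschitz hL) _.
rewrite /penalized -addrA lerD2l.
apply: le_trans (ler_wpM2l (ltW L0) hdist) _.
have MQ : 0 < M%:R :> rat by rewrite ltr0n.
have lamE : lam = (3 * L) ^+ 2 * (n.+1%:R * k%:R * M%:R).
  by rewrite /lam /penalty !(natrM, natrD) /L; ring.
rewrite mulrA; set c := L * 3; set X := \sum_i \sum_a `|_|; rewrite /X {X}.
have term i a : c * `|residual mu (table_P final) i a| <=
    lam * residual mu (table_P final) i a ^+ 2 + c ^+ 2 / (4 * lam) by exact: amgm.
rewrite mulr_sumr.
apply: (@le_trans _ _ (\sum_i (lam * \sum_a residual mu (table_P final) i a ^+ 2 +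
    c ^+ 2 / (4 * lam) * n.+1%:R))).
  apply: ler_sum => i _; rewrite -lerBlDl !mulr_sumr -sumrB.
  by apply: sum_le_const => a; rewrite lerBlDl.
rewrite big_split /= -mulr_sumr lerD2l.
apply: le_trans (sum_le_const (fun=> lexx _)) _.
rewrite lamE /c; rewrite le_eqVlt; apply/orP; left; apply/eqP; field.
by rewrite addrC natP !pnatr_eq0 -!lt0n M0 k0 /= gt_eqF.
Qed.

Lemma final_entriesE j : of_entries (final_entries O) j = table_P O j.
Proof. by rewrite /of_entries big_map. Qed.

Lemma solution_correct (R : realType) (eps : rat) : M%:R^-1 <= eps ->
  entry_list (solution b M Us C0 S) /\
  suboptimal_projection (fun i a => ratr (mu i a)) (to_real R Q) (ratr eps)
    (to_real R (of_entries (solution b M Us C0 S))).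
Proof.
move=> hM; have [_ _ pA aA] := sound_iterate (rounds b n.+1 k M).
rewrite -/final in pA aA.
have [/andP[gu gp] [O0 Om] _] := rounding_spec k0 hmu aA; rewrite -/C0 -/O in gu gp O0 Om.
rewrite -[solution _ _ _ _ _]/(final_entries O).
split.
  rewrite /entry_list /final_entries -map_comp gu all_map /=.
  by apply: sub_all gp => e /=; apply: lt0r_neq0.
have outE j : to_real R (of_entries (final_entries O)) j = to_real R (table_P O) j.
  by rewrite /to_real final_entriesE.
split; first split.
- by move=> j; rewrite outE /to_real ler0q.
- move=> i a; rewrite -Om -ratr_marginal.
  by apply: eq_bigr => j _; rewrite outE.
move=> P' hP'.
have -> : sq_dist (to_real R (of_entries (final_entries O))) (to_real R Q) =
    sq_dist (to_real R (table_P O)) (to_real R Q).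
  by apply: eq_bigr => j _; rewrite outE.
have hg := gap_final hP'.
have MR : 0 < M%:R :> R by rewrite ltr0n.
have hc : sq_dist (to_real R (table_P O)) (to_real R Q) <=
    penalized (ratr lam) (fun i a => ratr (mu i a)) (to_real R Q)
      (to_real R (table_P final)) + (4 * M%:R)^-1.
  rewrite ratr_sq_dist ratr_penalized -[M%:R](ratr_nat R) -[4](ratr_nat R).
  by rewrite -rmorphM -fmorphV -rmorphD ler_rat; exact: rounded_cost.
have he : M%:R^-1 <= ratr eps :> R.
  by rewrite -[M%:R](ratr_nat R) -fmorphV ler_rat.
have h2 : (2 * M%:R)^-1 = 2^-1 * M%:R^-1 :> R by rewrite invfM.
have h4 : (4 * M%:R)^-1 = 4^-1 * M%:R^-1 :> R by rewrite invfM.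
have h0 : 0 < M%:R^-1 :> R by rewrite invr_gt0.
apply: le_trans hc _; rewrite h4; rewrite h2 in hg.
move: hg; rewrite -[iterate _]/final.
set p := penalized _ _ _ _; set q := sq_dist _ _; lra.
Qed.

End Correct.

(** * Running time *)

Section RunningTime.
Variable b X : nat.
Hypothesis hX : (100 <= X)%N.
Notation runs := (runs (prog b)).

(** A function that makes a few calls of budget [e], fewer than a hundred, has
    budget [e + 1], and so does a loop of less than [X] rounds of budget [e];
    this keeps all the arithmetic on running times linear. *)
Definition budget e := (X ^ e)%N.
Lemma budgetS e : (100 * budget e <= budget e.+1)%N.
Proof. by rewrite /budget expnS leq_mul2r hX orbT. Qed.
Lemma budget_gt0 e : (0 < budget e)%N.
Proof. by rewrite expn_gt0; lia. Qed.
Lemma budget_loop e m : (m < X)%N -> (budget e * m.+1 <= budget e.+1)%N.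
Proof. by move=> h; rewrite /budget expnS mulnC leq_mul2r h orbT. Qed.

Lemma budget_mono e e' : (e <= e')%N -> (budget e <= budget e')%N.
Proof. by move=> h; rewrite leq_pexp2l //; lia. Qed.

Lemma runs_weaken f v w T T' : runs f v w T -> (T <= T')%N -> runs f v w T'.
Proof.
move=> [body hb [t h1 h2]] h; exists body => //; exists t => //.
exact: leq_trans h.
Qed.

Lemma pow_runs x m : (m < X)%N ->
  runs f_pow (enc_list [:: VNum x; VNum m%:R]) (VNum (x ^+ m)) (budget 2).
Proof.
move=> lt_mX; apply: (runs_weaken (T := budget 1 * m.+1)); last exact: budget_loop.
have := budgetS 0; rewrite [budget 0]expn0 => h0.
elim: m {lt_mX} => [|m IHm]; enter; eapply ev_weaken.
- rewrite /body_pow; steps; rewrite lexx; steps.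
- by [].
- lia.
- rewrite /body_pow; steps; rewrite nat_le0; steps; call IHm; by rewrite natS.
- by rewrite -exprS.
- rewrite (mulnS _ m.+1); lia.
Qed.

Lemma sum_runs r : (size r < X)%N ->
  runs f_sum (enc_row r) (VNum (sumr r)) (budget 2).
Proof.
move=> lt_rX; apply: (runs_weaken (T := budget 1 * (size r).+1)); last exact: budget_loop.
have := budgetS 0; rewrite [budget 0]expn0 => h0; rewrite /sumr.
elim: r {lt_rX} => [|x r IHr]; enter; eapply ev_weaken.
- rewrite /body_sum; eapply ev_match_nil; steps.
- by rewrite big_nil.
- lia.
- rewrite /body_sum; eapply ev_match_cons; steps; call IHr; reflexivity.
- by rewrite big_cons.
- rewrite /= (mulnS _ (size r).+1); lia.
Qed.

Definition small_rows (V : qmat) := all (fun r : qrow => size r < X)%N V.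
Definition small (V : qmat) := (size V < X)%N && small_rows V.

Lemma prodsum_runs V : small V ->
  runs f_prodsum (enc_mat V) (VNum (prodsum V)) (budget 4).
Proof.
move=> /andP[lt_VX]; move: (budget_loop 3 lt_VX) => le h.
apply: runs_weaken le; rewrite /prodsum.
have := budgetS 2; have := budgetS 1; have := budgetS 0; rewrite [budget 0]expn0 => h0 h1 h2.
elim: V h {lt_VX} => [|r V IHV] /= h; enter; eapply ev_weaken.
- rewrite /body_prodsum; eapply ev_match_nil; steps.
- by rewrite big_nil.
- lia.
- case/andP: h => hr hV; rewrite /body_prodsum; eapply ev_match_cons; steps.
  + by call (sum_runs hr).
  + by call (IHV hV).
- by rewrite big_cons.
- rewrite /= (mulnS _ (size V).+1); lia.
Qed.

Lemma prod_row_runs r r' : (size r < X)%N ->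
  runs f_prod_row (enc_list [:: enc_row r; enc_row r']) (enc_row (prod_row r r')) (budget 2).
Proof.
move=> /(budget_loop 1) le; apply: runs_weaken le.
have := budgetS 0; rewrite [budget 0]expn0 => h0.
elim: r r' => [|x r IHr] [|y r']; enter; eapply ev_weaken; try reflexivity.
- rewrite /body_prod_row; eapply ev_match_nil; steps.
- lia.
- rewrite /body_prod_row; eapply ev_match_nil; steps.
- lia.
- rewrite /body_prod_row; eapply ev_match_cons; steps; eapply ev_match_nil; steps.
- lia.
- rewrite /body_prod_row; eapply ev_match_cons; steps; eapply ev_match_cons; steps.
  by call (IHr r').
- rewrite /= (mulnS _ (size r).+1); lia.
Qed.

Lemma prod_mat_runs V U : small V ->
  runs f_prod_mat (enc_list [:: enc_mat V; enc_mat U]) (enc_mat (prod_mat V U)) (budget 4).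
Proof.
move=> /andP[/(budget_loop 3) le h]; apply: runs_weaken le.
have := budgetS 2; have := budgetS 1; have := budgetS 0; rewrite [budget 0]expn0 => h0 h1 h2.
elim: V U h => [|x r IHr] [|y r'] h; enter; eapply ev_weaken; try reflexivity.
- rewrite /body_prod_mat; eapply ev_match_nil; steps.
- lia.
- rewrite /body_prod_mat; eapply ev_match_nil; steps.
- lia.
- rewrite /body_prod_mat; eapply ev_match_cons; steps; eapply ev_match_nil; steps.
- lia.
- case/andP: h => hx hr.
  rewrite /body_prod_mat; eapply ev_match_cons; steps; eapply ev_match_cons; steps.
  + by call (@prod_row_runs x y).
  + by call (IHr r').
- rewrite /= (mulnS _ (size r).+1); lia.
Qed.

Lemma small_prod_mat V U : small V -> small (prod_mat V U).
Proof.
case/andP=> hV hr; apply/andP; split.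
  by rewrite size_map size_zip; apply: leq_ltn_trans hV; apply: geq_minl.
elim: V U hr {hV} => [|r V IHV] [|u U] //= /andP[hr hV].
rewrite IHV // andbT size_map size_zip; apply: leq_ltn_trans hr; exact: geq_minl.
Qed.

(** The two exponents that are added to that of the inner sum pay for one round
    and for the at most [X] rounds of the loop. *)
Lemma power_loop_runs N Us U e m d V :
  (forall m' V', (m' <= m)%N -> small V' ->
     runs f_power_sum (enc_list [:: enc_mats Us; VNum m'%:R; VNum N; enc_mat V'])
       (VNum (power_sum N Us m' V')) (budget (5 + e))) ->
  (m < X)%N -> small V ->
  runs f_power_loop (enc_list [:: enc_mat U; enc_mats Us; VNum m%:R; VNum d%:R;
                          VNum N; enc_mat V])
    (VNum (power_loop (power_sum N Us) U m d V)) (budget (7 + e)).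
Proof.
move=> hg /(budget_loop (6 + e)) le hV; apply: runs_weaken le.
have := budgetS (5 + e); have := budgetS (4 + e); rewrite -!addSn => h0 h1.
have := @budget_mono 4 (4 + e) (leq_addr _ _).
have := budgetS 0; rewrite [budget 0]expn0; have := @budget_mono 1 4 isT => h2 h3 h4.
elim: m d V hV hg => [|m IHm] d V hV hg; enter; eapply ev_weaken.
- rewrite /body_power_loop; steps.
  + by call (hg 0%N V).
  + rewrite lexx; steps.
- by [].
- lia.
- rewrite /body_power_loop; steps.
  + by call (hg m.+1 V).
  + rewrite nat_le0; steps; first by rewrite natP pnatr_eq0.
    call (IHm d.+1 (prod_mat V U)).
    * exact: small_prod_mat.
    * by move=> m' V' hm; apply: hg; apply: leqW.
    * by call (@prod_mat_runs V U).
    * by rewrite natS natP.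
- by [].
- rewrite /= (mulnS _ m.+1); lia.
Qed.

(** The recursion over the rank-one terms multiplies the cost by [X ^ 3] for
    each of them: this is where the rank has to be constant. *)
Lemma power_sum_runs N Us m V : (m < X)%N -> small V ->
  runs f_power_sum (enc_list [:: enc_mats Us; VNum m%:R; VNum N; enc_mat V])
    (VNum (power_sum N Us m V)) (budget (5 + 3 * size Us)).
Proof.
have := budgetS 4; have := budgetS 3; have := budgetS 2; have := budgetS 1.
have := budgetS 0; rewrite [budget 0]expn0 => h0 h1 h2 h3 h4.
elim: Us m V => [|U Us IHUs] m V hm hV; enter; eapply ev_weaken.
- rewrite /body_power_sum; eapply ev_match_nil; steps.
  + by call (@pow_runs N m).
  + by call (@prodsum_runs V).
- by [].
- rewrite /= addn0; lia.
- rewrite /body_power_sum; eapply ev_match_cons; steps.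
  call (@power_loop_runs N Us U (3 * size Us) m 0 V) => //.
  by move=> m' V' hm' hV'; apply: IHUs => //; apply: leq_ltn_trans hm.
- by [].
- have -> : (5 + 3 * size (U :: Us) = (7 + 3 * size Us).+1)%N by rewrite /=; lia.
  have := budgetS (7 + 3 * size Us); have := budget_gt0 (7 + 3 * size Us); lia.
Qed.
Lemma budget_chain : (100 <= budget 1 /\ 100 * budget 1 <= budget 2 /\ 100 * budget 2 <= budget 3 /\
  100 * budget 3 <= budget 4 /\ 100 * budget 4 <= budget 5 /\ 100 * budget 5 <= budget 6 /\
  100 * budget 6 <= budget 7)%N.
Proof. by do !split; try exact: budgetS; have := budgetS 0; rewrite [budget 0]expn0. Qed.

Lemma nth_runs r a : (size r < X)%N ->
  runs f_nth (enc_list [:: enc_row r; VNum a%:R]) (VNum (nth 0 r a)) (budget 2).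
Proof.
move=> /(budget_loop 1) le; apply: runs_weaken le.
have hc := budget_chain.
elim: r a => [|x r IHr] a; first (enter; eapply ev_weaken).
- rewrite /body_nth; eapply ev_match_nil; steps.
- by rewrite nth_nil.
- lia.
case: a => [|a]; enter; eapply ev_weaken.
- rewrite /body_nth; eapply ev_match_cons; steps; rewrite lexx; steps.
- by [].
- rewrite /= (mulnS _ (size r).+1); lia.
- rewrite /body_nth; eapply ev_match_cons; steps; rewrite nat_le0.
  call (IHr a); by rewrite natS.
- by [].
- rewrite /= (mulnS _ (size r).+1); lia.
Qed.

Lemma entry_prod_runs V j : small V ->
  runs f_entry_prod (enc_list [:: enc_mat V; enc_nats j]) (VNum (entry_prod V j)) (budget 4).
Proof.
move=> /andP[/(budget_loop 3) le h]; apply: runs_weaken le.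
have hc := budget_chain; rewrite /entry_prod.
elim: V j h => [|x r IHr] [|y r'] h; enter; eapply ev_weaken.
- rewrite /body_entry_prod; eapply ev_match_nil; steps.
- by rewrite big_nil.
- lia.
- rewrite /body_entry_prod; eapply ev_match_nil; steps.
- by rewrite big_nil.
- lia.
- rewrite /body_entry_prod; eapply ev_match_cons; steps; eapply ev_match_nil; steps.
- by rewrite big_nil.
- lia.
- case/andP: h => hx hr.
  rewrite /body_entry_prod; eapply ev_match_cons; steps; eapply ev_match_cons; steps.
  + by call (@nth_runs x y).
  + by call (IHr r').
- by rewrite /= big_cons.
- rewrite /= (mulnS _ (size r).+1); lia.
Qed.

Lemma cp_entry_runs Us j : (size Us < X)%N -> all small Us ->
  runs f_cp_entry (enc_list [:: enc_mats Us; enc_nats j]) (VNum (cp_entry Us j)) (budget 6).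
Proof.
move=> /(budget_loop 5) le h; apply: runs_weaken le.
have hc := budget_chain; rewrite /cp_entry.
elim: Us h => [|x r IHr] h; enter; eapply ev_weaken.
- rewrite /body_cp_entry; eapply ev_match_nil; steps.
- by rewrite big_nil.
- lia.
- case/andP: h => hx hr.
  rewrite /body_cp_entry; eapply ev_match_cons; steps.
  + by call (@entry_prod_runs x j).
  + by call IHr.
- by rewrite /= big_cons.
- rewrite /= (mulnS _ (size r).+1); lia.
Qed.

Lemma keep_runs r (a : rat) : (size r < X)%N ->
  runs f_keep (enc_list [:: enc_row r; VNum a]) (enc_row (keep r a)) (budget 2).
Proof.
move=> /(budget_loop 1) le; apply: runs_weaken le.
have hc := budget_chain.
elim: r a => [|x r IHr] a; enter; eapply ev_weaken.
- rewrite /body_keep; eapply ev_match_nil; steps.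
- by [].
- lia.
- rewrite /body_keep; eapply ev_match_cons; steps; last by call (IHr (a - 1)).
  by eapply ev_ifnum; steps.
- by [].
- rewrite /= (mulnS _ (size r).+1); lia.
Qed.

Lemma addrow_runs r (a q : rat) : (size r < X)%N ->
  runs f_addrow (enc_list [:: enc_row r; VNum a; VNum q]) (enc_row (addrow r a q)) (budget 2).
Proof.
move=> /(budget_loop 1) le; apply: runs_weaken le.
have hc := budget_chain.
elim: r a => [|x r IHr] a; enter; eapply ev_weaken.
- rewrite /body_addrow; eapply ev_match_nil; steps.
- by [].
- lia.
- rewrite /body_addrow; eapply ev_match_cons; steps; last by call (IHr (a - 1)).
  by eapply ev_ifnum; steps.
- by [].
- rewrite /= (mulnS _ (size r).+1); lia.
Qed.

Lemma addat_runs C j q : small C ->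
  runs f_addat (enc_list [:: enc_mat C; enc_nats j; VNum q]) (enc_mat (addat C j q)) (budget 4).
Proof.
move=> /andP[/(budget_loop 3) le h]; apply: runs_weaken le.
have hc := budget_chain.
elim: C j h => [|x r IHr] [|y r'] h; enter; eapply ev_weaken; try reflexivity.
- rewrite /body_addat; eapply ev_match_nil; steps.
- lia.
- rewrite /body_addat; eapply ev_match_nil; steps.
- lia.
- rewrite /body_addat; eapply ev_match_cons; steps; eapply ev_match_nil; steps.
- lia.
- case/andP: h => hx hr.
  rewrite /body_addat; eapply ev_match_cons; steps; eapply ev_match_cons; steps.
  + by call (@addrow_runs x y%:R q).
  + by call (IHr r').
- rewrite /= (mulnS _ (size r).+1); lia.
Qed.

Lemma revapp_runs V W : (size V < X)%N ->
  runs f_revapp (enc_list [:: enc_mat V; enc_mat W]) (enc_mat (catrev V W)) (budget 2).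
Proof.
move=> /(budget_loop 1) le; apply: runs_weaken le.
have hc := budget_chain.
elim: V W => [|x r IHr] W; enter; eapply ev_weaken.
- rewrite /body_revapp; eapply ev_match_nil; steps.
- by [].
- lia.
- rewrite /body_revapp; eapply ev_match_cons; steps; by call (IHr (x :: W)).
- by [].
- rewrite /= (mulnS _ (size r).+1); lia.
Qed.

Lemma weight_row_runs r lam N D : (size r < X)%N -> (D < X)%N ->
  runs f_weight_row (enc_list [:: enc_row r; VNum lam; VNum N; VNum D%:R])
    (enc_row (weight_row lam N D r)) (budget 4).
Proof.
move=> /(budget_loop 3) le hD; apply: runs_weaken le.
have hc := budget_chain.
elim: r => [|x r IHr]; enter; eapply ev_weaken.
- rewrite /body_weight_row; eapply ev_match_nil; steps.
- by [].
- lia.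
- rewrite /body_weight_row; eapply ev_match_cons; steps.
  + by call (@pow_runs (N + lam * x) D).
  + by call IHr.
- by [].
- rewrite /= (mulnS _ (size r).+1); lia.
Qed.

Lemma weight_mat_runs V lam N D : small V -> (D < X)%N ->
  runs f_weight_mat (enc_list [:: enc_mat V; VNum lam; VNum N; VNum D%:R])
    (enc_mat (weight_mat lam N D V)) (budget 6).
Proof.
move=> /andP[/(budget_loop 5) le h hD]; apply: runs_weaken le.
have hc := budget_chain.
elim: V h => [|x r IHr] h; enter; eapply ev_weaken.
- rewrite /body_weight_mat; eapply ev_match_nil; steps.
- by [].
- lia.
- case/andP: h => hx hr.
  rewrite /body_weight_mat; eapply ev_match_cons; steps.
  + by call (@weight_row_runs x lam N D).
  + by call IHr.
- by [].
- rewrite /= (mulnS _ (size r).+1); lia.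
Qed.

Lemma mincap_runs C j q : small C ->
  runs f_mincap (enc_list [:: enc_mat C; enc_nats j; VNum q]) (VNum (mincap C j q)) (budget 4).
Proof.
move=> /andP[/(budget_loop 3) le h]; apply: runs_weaken le.
have hc := budget_chain.
elim: C j q h => [|x r IHr] [|y r'] q h; enter; eapply ev_weaken; try reflexivity.
- rewrite /body_mincap; eapply ev_match_nil; steps.
- lia.
- rewrite /body_mincap; eapply ev_match_nil; steps.
- lia.
- rewrite /body_mincap; eapply ev_match_cons; steps; eapply ev_match_nil; steps.
- lia.
- case/andP: h => hx hr.
  rewrite /body_mincap; eapply ev_match_cons; steps; eapply ev_match_cons; steps.
  + by call (@nth_runs x y).
  + call (IHr r' (if q <= nth 0 x y then q else nth 0 x y)) => //.
    * by eapply ev_ifnum; steps.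
- rewrite /= (mulnS _ (size r).+1); lia.
Qed.

Lemma firstpos_runs r : (size r < X)%N ->
  runs f_firstpos (enc_row r) (VNum (firstpos r)%:R) (budget 2).
Proof.
move=> /(budget_loop 1) le; apply: runs_weaken le.
have hc := budget_chain.
elim: r => [|x r IHr]; first (enter; eapply ev_weaken).
- rewrite /body_firstpos; eapply ev_match_nil; steps.
- by [].
- lia.
case: (boolP (x <= 0)) => hx; last first.
  enter; eapply ev_weaken.
  - by rewrite /body_firstpos; eapply ev_match_cons; steps; rewrite (negbTE hx); steps.
  - by rewrite /= (negbTE hx).
  - rewrite /= (mulnS _ (size r).+1); lia.
case: r IHr => [|y r] IHr; enter; eapply ev_weaken.
- rewrite /body_firstpos; eapply ev_match_cons; steps; rewrite hx; eapply ev_match_nil; steps.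
- by rewrite /= hx.
- by rewrite /=; lia.
- rewrite /body_firstpos; eapply ev_match_cons; steps; rewrite hx; eapply ev_match_cons; steps.
  by call IHr.
- by rewrite addrC natP [in RHS]/= hx.
- rewrite /= (mulnS _ (size r).+2); lia.
Qed.

Lemma small_catrev pre rest : small (catrev pre rest) =
  (size pre + size rest < X)%N && (small_rows pre && small_rows rest).
Proof.
by rewrite /small catrevE size_cat size_rev /small_rows all_cat all_rev.
Qed.

Lemma small_addat C j q : small C -> small (addat C j q).
Proof.
case/andP=> hV hr; apply/andP; split.
  by rewrite size_map size_zip; apply: leq_ltn_trans hV; apply: geq_minl.
elim: C j hr {hV} => [|r V IHV] [|u U] //= /andP[hr hV].
by rewrite IHV // andbT size_addrow.
Qed.

Section Table.
Variables n k : nat.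
Hypotheses (hn : (n < X)%N) (hk : (k < X)%N).
Notation idx := (multi_index n.+1 k).
Notation table := (table n k).

Lemma corr_runs (A : table) V Us D N :
  (size A < X)%N -> small V -> (size Us < X)%N -> all small Us -> (D < X)%N ->
  runs f_corr (enc_list [:: enc_table A; enc_mat V; enc_mats Us; VNum D%:R; VNum N])
    (VNum (corr A V Us D N)) (budget 8).
Proof.
move=> /(budget_loop 7) le hV hUs1 hUs2 hD; apply: runs_weaken le.
have hc := budget_chain; rewrite /corr.
elim: A => [|e A IHA]; enter; eapply ev_weaken.
- rewrite /body_corr; eapply ev_match_nil; steps.
- by rewrite big_nil.
- lia.
- rewrite /body_corr; eapply ev_match_cons; steps.
  + by call (@cp_entry_runs Us (nats e.1)); rewrite // enc_indexE.
  + by call (@entry_prod_runs V (nats e.1)); rewrite // enc_indexE.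
  + by call (@pow_runs (N + cp_entry Us (nats e.1) + (e.2.1 - e.2.2)) D).
  + by call (@pow_runs (N + cp_entry Us (nats e.1)) D).
  + by call IHA.
- by rewrite /= big_cons.
- rewrite /= (mulnS _ (size A).+1); lia.
Qed.

Section Ctx.
Variables (Us : seq qmat) (D : nat) (N : rat) (A : table).
Hypotheses (hA : (size A < X)%N) (hUs1 : (size Us < X)%N)
  (hUs2 : all small Us) (hD : (D < X)%N).
Let ctx := enc_list [:: enc_mats Us; VNum D%:R; VNum N; enc_table A].
Let R := (3 * size Us)%N.

Lemma potential_runs V : small V ->
  runs f_potential (VCons (enc_mat V) ctx) (VNum (potential Us D N A V)) (budget (9 + R)).
Proof.
move=> hV; have hc := budget_chain.
have h1 : (100 * budget (8 + R) <= budget (9 + R))%N := budgetS (8 + R).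
have h2 := budget_mono (leq_addr R 8); have h3 := @budget_mono (5 + R) (8 + R) ltac:(lia).
have h4 : (100 <= budget 8)%N by have := budgetS 7; have := budget_gt0 7; lia.
enter; eapply ev_weaken.
- change (VCons (enc_mat V) ctx) with
    (enc_list [:: enc_mat V; enc_mats Us; VNum D%:R; VNum N; enc_table A]).
  rewrite /body_potential; steps.
  + by call (@power_sum_runs N Us D V).
  + by call (@corr_runs A V Us D N).
- by [].
- rewrite -/R; lia.
Qed.

Lemma search_runs t pre r rest a :
  (a < X)%N -> small (catrev pre (r :: rest)) ->
  runs f_search (enc_list [:: VNum a%:R; VNum t; VNum n.+1%:R; enc_mat pre;
                             enc_row r; enc_mat rest; ctx])
    (VNum (search n (potential Us D N A) t pre r rest a)%:R) (budget (11 + R)).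
Proof.
move=> /(budget_loop (10 + R)) le h; apply: runs_weaken le.
have hc := budget_chain.
have h1 := budgetS (9 + R).
have h2 := @budget_mono 9 (9 + R) (leq_addr R 9).
have h3 := @budget_mono 3 9 isT.
move: (h); rewrite small_catrev /= => /and3P[hs hpre /andP[hr hrest]].
rewrite -[(10 + R)%N]/(9 + R).+1.
elim: a => [|a IHa]; enter; eapply ev_weaken.
- rewrite /body_search; steps; rewrite lexx; steps.
- by [].
- lia.
- rewrite /body_search; steps; rewrite nat_le0; steps.
  + call (@potential_runs (catrev pre (keep r a.+1%:R :: rest))).
    * by rewrite small_catrev /= hs hpre size_keep hr.
    * call (@revapp_runs pre (keep r a.+1%:R :: rest)).
      - by apply: leq_ltn_trans hs; apply: leq_addr.
      - by call (@keep_runs r a.+1%:R).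
      - by [].
    * by [].
  + eapply ev_ifnum; steps.
    by call IHa; rewrite natS.
- by rewrite /=; case: ifP.
- rewrite /= (mulnS _ a.+1); lia.
Qed.

Lemma greedy_index_runs pre rest : small (catrev pre rest) ->
  runs f_greedy_index (enc_list [:: enc_mat pre; enc_mat rest; VNum n.+1%:R; ctx])
    (enc_nats (greedy_index n (potential Us D N A) pre rest)) (budget (13 + R)).
Proof.
move=> h.
have /(budget_loop (12 + R)) le : (size rest < X)%N.
  move: h; rewrite small_catrev => /andP[h _].
  by apply: leq_ltn_trans h; apply: leq_addl.
apply: runs_weaken le.
have hc := budget_chain.
have h1 := budgetS (11 + R).
have h2 := @budget_mono 11 (11 + R) (leq_addr R 11).
have h3 := @budget_mono 3 11 isT.
have h4 := @budget_mono (9 + R) (11 + R) ltac:(lia).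
rewrite -[(12 + R)%N]/(11 + R).+1.
elim: rest pre h => [|r rest IHr] pre h; enter; eapply ev_weaken.
- rewrite /body_greedy_index; eapply ev_match_nil; steps.
- by [].
- lia.
- move: (h); rewrite small_catrev /= => /and3P[hs hpre /andP[hr hrest]].
  rewrite /body_greedy_index; eapply ev_match_cons; steps.
  + call (@search_runs (potential Us D N A (catrev pre (r :: rest))) pre r rest n) => //.
    * call (@potential_runs (catrev pre (r :: rest))) => //.
      by call (@revapp_runs pre (r :: rest)); rewrite //; apply: leq_ltn_trans hs; apply: leq_addr.
    * by rewrite natS.
  + set a := search n _ _ pre r rest n.
    call (IHr (keep r a%:R :: pre)).
    * by rewrite small_catrev /= size_keep hr hpre hrest addSnnS hs.
    * by call (@keep_runs r a%:R).
    * by [].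
- by [].
- rewrite /= (mulnS _ (size rest).+1); lia.
Qed.
End Ctx.

Lemma residual_mat_runs (A : table) C : (size A < X)%N -> small C ->
  runs f_residual_mat (enc_list [:: enc_table A; enc_mat C]) (enc_mat (residual_mat A C)) (budget 6).
Proof.
move=> /(budget_loop 5) le h; apply: runs_weaken le.
have hc := budget_chain.
elim: A C h => [|e A IHA] C h; enter; eapply ev_weaken.
- rewrite /body_residual_mat; eapply ev_match_nil; steps.
- by [].
- lia.
- rewrite /body_residual_mat; eapply ev_match_cons; steps.
  call (IHA (addat C (nats e.1) (- e.2.2))); first exact: small_addat.
  + by call (@addat_runs C (nats e.1) (- e.2.2)); rewrite // ?enc_indexE ?sub0r.
  + by [].
- by [].
- rewrite /= (mulnS _ (size A).+1); lia.
Qed.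

Lemma eqidx_runs (s s' : seq nat) : size s = size s' -> (size s < X)%N ->
  runs f_eqidx (enc_list [:: enc_nats s; enc_nats s']) (VNum (s == s')%:R) (budget 2).
Proof.
move=> hs /(budget_loop 1) le; apply: runs_weaken le.
have hc := budget_chain.
elim: s s' hs => [|x s IHs] [|y s'] // hs; enter; eapply ev_weaken.
- rewrite /body_eqidx; eapply ev_match_nil; steps.
- by [].
- lia.
- rewrite /body_eqidx; eapply ev_match_cons; steps; eapply ev_match_cons; steps.
  case: hs => hs; by eapply ev_ifnum; steps; call (IHs s').
- by rewrite eqr_nat eqseq_cons; case: (x == y).
- rewrite /= (mulnS _ (size s).+1); lia.
Qed.

Lemma add_entry_runs (j : idx) q (A : table) : (size A < X)%N ->
  runs f_add_entry (enc_list [:: enc_index j; VNum q; enc_table A])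
    (enc_table (add_entry j q A)) (budget 4).
Proof.
move=> /(budget_loop 3) le; apply: runs_weaken le.
have hc := budget_chain.
elim: A => [|e A IHA]; first (enter; eapply ev_weaken).
- rewrite /body_add_entry; eapply ev_match_nil; steps.
- by [].
- lia.
have heq := @eqidx_runs (nats e.1) (nats j).
rewrite !size_nats in heq; have {heq} heq := heq erefl hk.
rewrite (_ : (nats e.1 == nats j) = (e.1 == j)) in heq; last first.
  by rewrite /nats (inj_eq (inj_map val_inj)).
case: (boolP (e.1 == j)) heq => hej heq; enter; eapply ev_weaken.
- rewrite /body_add_entry; eapply ev_match_cons; steps; first by call heq; rewrite !enc_indexE.
  rewrite lexx; steps.
- by rewrite /= hej.
- rewrite /= (mulnS _ (size A).+1); lia.
- rewrite /body_add_entry; eapply ev_match_cons; steps; first by call heq; rewrite !enc_indexE.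
  rewrite [_ <= _](ler10 rat); steps; by call IHA.
- by rewrite /= (negbTE hej).
- rewrite /= (mulnS _ (size A).+1); lia.
Qed.

Lemma scale_runs g (A : table) : (size A < X)%N ->
  runs f_scale (enc_list [:: VNum g; enc_table A]) (enc_table (scale g A)) (budget 2).
Proof.
move=> /(budget_loop 1) le; apply: runs_weaken le.
have hc := budget_chain.
elim: A => [|e A IHA]; enter; eapply ev_weaken.
- rewrite /body_scale; eapply ev_match_nil; steps.
- by [].
- lia.
- by rewrite /body_scale; eapply ev_match_cons; steps; call IHA.
- by [].
- rewrite /= (mulnS _ (size A).+1); lia.
Qed.

Lemma init_runs (s : seq (idx * rat)) : (size s < X)%N ->
  runs f_init (enc_entries s) (enc_table (init_table s)) (budget 2).
Proof.
move=> /(budget_loop 1) le; apply: runs_weaken le.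
have hc := budget_chain.
elim: s => [|e s IHs]; enter; eapply ev_weaken.
- rewrite /body_init; eapply ev_match_nil; steps.
- by [].
- lia.
- by rewrite /body_init; eapply ev_match_cons; steps; call IHs.
- by [].
- rewrite /= (mulnS _ (size s).+1); lia.
Qed.

Lemma final_runs (A : table) : (size A < X)%N ->
  runs f_final (enc_table A) (enc_entries (final_entries A)) (budget 2).
Proof.
move=> /(budget_loop 1) le; apply: runs_weaken le.
have hc := budget_chain.
elim: A => [|e s IHs]; enter; eapply ev_weaken.
- rewrite /body_final; eapply ev_match_nil; steps.
- by [].
- lia.
- by rewrite /body_final; eapply ev_match_cons; steps; call IHs.
- by [].
- rewrite /= (mulnS _ (size s).+1); lia.
Qed.

Lemma firstidx_runs (C : qmat) : small C -> size C = k -> all (fun r => size r == n.+1) C ->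
  runs f_firstidx (enc_mat C) (enc_index (firstidx n k C)) (budget 4).
Proof.
move=> /andP[/(budget_loop 3) le h] hC hr; apply: runs_weaken le.
rewrite enc_indexE /firstidx nats_toidx; first last.
- by rewrite all_map; apply: sub_all hr => r /= /eqP; apply: firstpos_lt.
- by rewrite size_map.
have hc := budget_chain.
elim: C h {hC hr} => [|r C IHC] h; enter; eapply ev_weaken.
- rewrite /body_firstidx; eapply ev_match_nil; steps.
- by [].
- lia.
- case/andP: h => hr hC.
  rewrite /body_firstidx; eapply ev_match_cons; steps.
  + by call (@firstpos_runs r).
  + by call IHC.
- by [].
- rewrite /= (mulnS _ (size C).+1); lia.
Qed.

Definition enc_pair (CO : qmat * table) := VCons (enc_mat CO.1) (enc_table CO.2).

Lemma pour_runs (j : idx) q (CO : qmat * table) : small CO.1 -> (size CO.2 < X)%N ->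
  runs f_pour (enc_list [:: enc_index j; VNum q; enc_mat CO.1; enc_table CO.2])
    (enc_pair (pour j q CO)) (budget 5).
Proof.
move=> hC hO; have hc := budget_chain.
case: (boolP (mincap CO.1 (nats j) q <= 0)) => hz; enter; eapply ev_weaken.
- rewrite /body_pour; steps.
  + by call (@mincap_runs CO.1 (nats j) q); rewrite // enc_indexE.
  + rewrite hz; steps.
- by rewrite /pour hz.
- lia.
- rewrite /body_pour; steps.
  + by call (@mincap_runs CO.1 (nats j) q); rewrite // enc_indexE.
  + rewrite (negbTE hz); steps.
    * by call (@addat_runs CO.1 (nats j) (- mincap CO.1 (nats j) q)); rewrite // ?enc_indexE ?sub0r.
    * by call (@add_entry_runs j (mincap CO.1 (nats j) q) CO.2).
- by rewrite /pour (negbTE hz).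
- lia.
Qed.

Lemma small_pour j q CO : small CO.1 -> small (@pour n k j q CO).1.
Proof. by rewrite /pour; case: ifP => // _ h; apply: small_addat. Qed.

Lemma pourall_runs (A : table) (CO : qmat * table) : small CO.1 -> (size A + size CO.2 < X)%N ->
  runs f_pourall (enc_list [:: enc_table A; enc_mat CO.1; enc_table CO.2])
    (enc_pair (pourall A CO)) (budget 7).
Proof.
move=> hC hO; have hc := budget_chain.
apply: (runs_weaken (T := budget 6 * (size A).+1)); last first.
  by apply: budget_loop; apply: leq_ltn_trans hO; apply: leq_addr.
elim: A CO hC hO => [|e A IHA] CO hC hO; enter; eapply ev_weaken.
- rewrite /body_pourall; eapply ev_match_nil; steps.
- by [].
- lia.
- rewrite /body_pourall; eapply ev_match_cons; steps.
  + call (@pour_runs e.1 e.2.2 CO) => //.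
    by apply: leq_ltn_trans hO; apply: leq_addl.
  + call (IHA (pour e.1 e.2.2 CO)); first exact: small_pour.
    * by apply: leq_ltn_trans (leq_add (leqnn _) (size_pour _ _ _)) _; rewrite addnS -addSn.
    * by [].
- by [].
- rewrite /= (mulnS _ (size A).+1); lia.
Qed.

Lemma fill_corners_runs m (CO : qmat * table) : small CO.1 -> (m + size CO.2 < X)%N ->
  size CO.1 = k -> all (fun r => size r == n.+1) CO.1 ->
  runs f_fill_corners (enc_list [:: VNum m%:R; enc_mat CO.1; enc_table CO.2])
    (enc_table (fill_corners m CO).2) (budget 7).
Proof.
move=> hC hO; have hc := budget_chain => hs hr.
apply: (runs_weaken (T := budget 6 * m.+1)); last first.
  by apply: budget_loop; apply: leq_ltn_trans hO; apply: leq_addr.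
elim: m CO hC hO hs hr => [|m IHm] CO hC hO hs hr; enter; eapply ev_weaken.
- rewrite /body_fill_corners; steps; rewrite lexx; steps.
- by [].
- lia.
- rewrite /body_fill_corners; steps; rewrite nat_le0; steps.
  + call (@pour_runs (firstidx n k CO.1) 1 CO) => //.
      by apply: leq_ltn_trans hO; apply: leq_addl.
    by call (@firstidx_runs CO.1).
  + call (IHm (pour (firstidx n k CO.1) 1 CO)); first exact: small_pour.
    * by apply: leq_ltn_trans (leq_add (leqnn _) (size_pour _ _ _)) _; rewrite addnS -addSn.
    * by rewrite /pour; case: ifP => // _; apply: size_addat.
    * by rewrite /pour; case: ifP => // _; apply: all_size_addat.
    * by rewrite natS.
- by rewrite /fill_corners iterSr.
- rewrite /= (mulnS _ m.+1); lia.
Qed.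

Lemma small_residual_mat (A : table) C : small C -> small (residual_mat A C).
Proof.
rewrite /residual_mat; elim: A C => [|e A IHA] C //= hC; apply: IHA; exact: small_addat.
Qed.

Lemma small_weight_mat lam N D V : small V -> small (weight_mat lam N D V).
Proof.
rewrite /small /weight_mat size_map => /andP[-> h] /=.
by rewrite /small_rows all_map; apply: sub_all h => r /=; rewrite size_map.
Qed.

Lemma iter_runs m g (A : table) Us D N lam mu :
  (m + size A < X)%N -> (size Us < X)%N -> all small Us -> (D < X)%N ->
  small mu -> size mu = k ->
  runs f_iter (enc_list [:: VNum m%:R; VNum g; enc_table A; enc_mats Us;
      VNum D%:R; VNum N; VNum lam; VNum n.+1%:R; enc_mat mu])
    (enc_table (iter m (fw_step g Us D N lam mu) A)) (budget (15 + 3 * size Us)).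
Proof.
move=> hA hUs1 hUs2 hD hmu hk'.
set R := (3 * size Us)%N.
apply: (runs_weaken (T := budget (14 + R) * m.+1)); last first.
  by apply: budget_loop; apply: leq_ltn_trans hA; apply: leq_addr.
have hc := budget_chain.
have h1 := budgetS (13 + R).
have h2 := @budget_mono 13 (13 + R) (leq_addr R 13).
have h3 := @budget_mono 7 13 isT.
rewrite -[(14 + R)%N]/(13 + R).+1.
elim: m A hA => [|m IHm] A hA; enter; eapply ev_weaken.
- rewrite /body_iter; steps; rewrite lexx; steps.
- by [].
- lia.
- have hA' : (size A < X)%N by apply: leq_ltn_trans hA; apply: leq_addl.
  rewrite /body_iter; steps; rewrite nat_le0.
  call (IHm (fw_step g Us D N lam mu A)).
  + rewrite /fw_step; set j := toidx _ _ _.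
    apply: leq_ltn_trans (leq_add (leqnn m) (size_add_entry j g _)) _.
    by rewrite size_map addnS -addSn.
  + set V := weight_mat lam N D (residual_mat A mu).
    set j := greedy_index n (potential Us D N A) [::] V.
    call (@add_entry_runs (toidx n k j) g (scale (1 - g) A)).
    * by rewrite size_map.
    * call (@greedy_index_runs Us D N A hA' hUs1 hUs2 hD [::] V).
      - by apply: small_weight_mat; apply: small_residual_mat.
      - call (@weight_mat_runs (residual_mat A mu) lam N D) => //; first exact: small_residual_mat.
        by call (@residual_mat_runs A mu).
      - by [].
    * by call (@scale_runs (1 - g) A).
    * rewrite enc_indexE nats_toidx ?greedy_index_lt // size_greedy_index size_map.
      exact: size_residual_mat.
  + by rewrite natS.
- by rewrite iterSr.
- rewrite /= -/R (mulnS _ m.+1); lia.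
Qed.

End Table.
Lemma all_size_pourall n k (A : table n k) CO : all (fun r => size r == n.+1) CO.1 ->
  all (fun r => size r == n.+1) (pourall A CO).1.
Proof.
rewrite /pourall; elim: A CO => //= e A IHA CO h; apply: IHA.
by rewrite /pour; case: ifP => // _; apply: all_size_addat.
Qed.

Lemma size_pourall1 n k (A : table n k) CO : size CO.1 = k -> size (pourall A CO).1 = k.
Proof.
rewrite /pourall; elim: A CO => //= e A IHA CO h; apply: IHA.
by rewrite /pour; case: ifP => // _; apply: size_addat.
Qed.

Lemma small_pourall n k (A : table n k) CO : small CO.1 -> small (pourall A CO).1.
Proof.
rewrite /pourall; elim: A CO => //= e A IHA CO h; apply: IHA; exact: small_pour.
Qed.

Lemma small_mat_of k n (f : 'I_k -> 'I_n -> rat) :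
  (k < X)%N -> (n < X)%N -> small (mat_of f).
Proof.
move=> hk hn; rewrite /small size_mat_of hk.
by apply: sub_all (all_size_mat_of f) => r /eqP ->.
Qed.

Lemma ceil_runs eps : 0 < eps -> (accuracy eps < X)%N ->
  runs f_ceil (enc_list [:: VNum 0; VNum eps]) (VNum (accuracy eps)%:R) (budget 2).
Proof.
move=> eps0 hM; have hc := budget_chain.
suff H d m : (m + d = accuracy eps)%N ->
    runs f_ceil (enc_list [:: VNum m%:R; VNum eps]) (VNum (accuracy eps)%:R) (budget 1 * d.+1).
  by apply: runs_weaken (H (accuracy eps) 0%N (add0n _)) _; apply: budget_loop.
elim: d m => [|d IHd] m hd.
  rewrite addn0 in hd; enter; eapply ev_weaken.
  - rewrite /body_ceil; steps.
    have -> : (m%:R * eps <= 1) = false.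
      apply/negbTE; rewrite -ltNge -ltr_pdivrMr // div1r hd.
      by have /truncn_itv/andP[] : 0 <= eps^-1 by rewrite invr_ge0 ltW.
    steps.
  - by rewrite hd.
  - lia.
enter; eapply ev_weaken.
- rewrite /body_ceil; steps.
  have -> : (m%:R * eps <= 1) = true.
    rewrite -ler_pdivlMr // div1r -truncn_ge_nat ?invr_ge0 ?ltW //.
    by rewrite -ltnS -/(accuracy eps) -hd -addSnnS leq_addr.
  by call (IHd m.+1); rewrite ?natP // addSnnS.
- by [].
- rewrite (mulnS _ d.+1); lia.
Qed.

Variables (n k r : nat) (u : 'I_r -> 'I_k -> 'I_n.+1 -> rat)
  (mu : 'I_k -> 'I_n.+1 -> rat) (S : seq (multi_index n.+1 k * rat)) (eps : rat).
Let M := accuracy eps.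
Hypotheses (eps0 : 0 < eps) (hM : (M < X)%N) (hn : (n.+1 < X)%N) (hk : (k < X)%N)
  (hr : (r < X)%N) (hD : (power b n.+1 k M < X)%N)
  (hS : (n.+1 * k + (rounds b n.+1 k M + size S) < X)%N)
  (hs : (0 < inv_step b n.+1 k M)%N).

Lemma main_runs :
  runs 0 (enc_input u S mu eps)
    (enc_entries (solution b M (mats_of u) (mat_of mu) S)) (budget (17 + 3 * r)).
Proof.
have hc := budget_chain.
have hUs : size (mats_of u) = r by rewrite size_map size_enum_ord.
have hmu : small (mat_of mu) by apply: small_mat_of.
have h1 : (100 * budget (16 + 3 * r) <= budget (17 + 3 * r))%N := budgetS (16 + 3 * r).
have h2 : (100 * budget (15 + 3 * r) <= budget (16 + 3 * r))%N := budgetS (15 + 3 * r).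
have h3 := @budget_mono 7 (15 + 3 * r) ltac:(lia).
have hfw := @size_fw_table b n k M (mats_of u) (mat_of mu) S.
rewrite /enc_input enc_mats_of enc_mat_of.
enter; eapply ev_weaken.
- rewrite /body_main; steps.
  + by call (@ceil_runs eps).
  + call (@iter_runs n k (ltnW hn) hk (rounds b n.+1 k M)
      (inv_step b n.+1 k M)%:R^-1 (init_table S) (mats_of u) (power b n.+1 k M)
      (shift b n.+1 k M)%:R (penalty b n.+1 k M)%:R (mat_of mu)) => //.
    * by rewrite size_map; apply: leq_ltn_trans hS; apply: leq_addl.
    * by rewrite hUs.
    * by apply/allP => V /mapP[l _ ->]; apply: small_mat_of.
    * exact: size_mat_of.
    * apply: lt0r_neq0; move: hs; rewrite -(ltr_nat rat) /inv_step /penalty.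
      by rewrite !(natrM, natrD).
    * call (@init_runs n k (ltnW hn) hk S) => //.
      by apply: leq_ltn_trans hS; rewrite addnA leq_addl.
    * rewrite div1r /rounds /power /shift /inv_step /range /penalty -/M.
      by rewrite !(natrM, natrD).
  + call (@pourall_runs n k (ltnW hn) hk
      (fw_table b M (mats_of u) (mat_of mu) S) (mat_of mu, [::])) => //.
    rewrite addn0; apply: leq_ltn_trans hS; apply: leq_trans hfw _; exact: leq_addl.
  + call (@final_runs n k (ltnW hn) hk).
    2: call (@fill_corners_runs n k (ltnW hn) hk (n.+1 * k)
      (pourall (fw_table b M (mats_of u) (mat_of mu) S) (mat_of mu, [::]))).
    all: try reflexivity.
  - have := size_solution b M (mats_of u) (mat_of mu) S; rewrite size_map.
    by move=> h; apply: leq_ltn_trans hS.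
  - exact: small_pourall.
  - apply: leq_ltn_trans hS; rewrite leq_add2l; apply: leq_trans (size_pourall _ _) _.
    by rewrite addn0.
  - apply: size_pourall1; exact: size_mat_of.
  - apply: all_size_pourall; exact: all_size_mat_of.
  - by rewrite natrM.
- rewrite hUs; lia.
Qed.

Lemma main_computes : exists2 t, (t <= budget (18 + 3 * r))%N &
  computes (prog b) (enc_input u S mu eps)
    (enc_entries (solution b M (mats_of u) (mat_of mu) S)) t.
Proof.
have [t le_t et] : ev (prog b) [:: enc_input u S mu eps] (Call 0 (Var 0))
    (enc_entries (solution b M (mats_of u) (mat_of mu) S)) (budget (18 + 3 * r)).
  eapply ev_weaken.
  - by call main_runs.
  - by [].
  - have h1 : (100 * budget (17 + 3 * r) <= budget (18 + 3 * r))%N := budgetS (17 + 3 * r).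
    have : (1 <= budget (17 + 3 * r))%N := budget_gt0 _.
    lia.
by exists t.
Qed.
End RunningTime.

(** * Polynomial bounds and the theorem *)

Section PolyBounded.
Implicit Types f : nat -> nat -> rat -> nat.

(** The class of functions with a bound of the shape [poly_nk_eps] is closed
    under the operations from which [resource] is built. *)
Definition poly_bounded f := exists c, forall n k eps,
  (0 < n)%N -> (0 < k)%N -> 0 < eps -> (f n k eps)%:R <= poly_nk_eps c n k eps.

Let size_measure (n k : nat) (eps : rat) : rat := n%:R + k%:R + eps^-1.

Lemma measure_ge1 n k eps : (0 < n)%N -> 0 < eps -> 1 <= size_measure n k eps.
Proof.
move=> n0 e0; rewrite /size_measure -addrA ler_wpDr ?ler1n //.
by rewrite addr_ge0 // invr_ge0 ltW.
Qed.

Lemma poly_nk_eps_mono a e c n k eps : (0 < n)%N -> 0 < eps ->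
  (a <= c)%N -> (e <= c)%N ->
  a%:R * size_measure n k eps ^+ e <= poly_nk_eps c n k eps.
Proof.
move=> n0 e0 hac hec; have z1 := measure_ge1 k n0 e0.
rewrite ler_pM ?ler_nat // ?exprn_ge0 ?(le_trans ler01) //.
exact: ler_weXn2l.
Qed.

Lemma poly_const a : poly_bounded (fun _ _ _ => a).
Proof.
exists a => n k eps n0 k0 e0.
by have := @poly_nk_eps_mono a 0 a n k eps n0 e0 (leqnn _) (leq0n _); rewrite mulr1.
Qed.

Lemma poly_add f f' : poly_bounded f -> poly_bounded f' ->
  poly_bounded (fun n k eps => f n k eps + f' n k eps)%N.
Proof.
move=> [c hc] [c' hc']; exists (c + c')%N => n k eps n0 k0 e0.
rewrite natrD; apply: le_trans (lerD (hc _ _ _ n0 k0 e0) (hc' _ _ _ n0 k0 e0)) _.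
have z1 := measure_ge1 k n0 e0.
rewrite /poly_nk_eps natrD mulrDl -/(size_measure n k eps).
by apply: lerD; rewrite ler_wpM2l // ler_weXn2l // ?leq_addr ?leq_addl.
Qed.

Lemma poly_mul f f' : poly_bounded f -> poly_bounded f' ->
  poly_bounded (fun n k eps => f n k eps * f' n k eps)%N.
Proof.
move=> [c hc] [c' hc']; exists (c * c' + (c + c'))%N => n k eps n0 k0 e0.
rewrite natrM; apply: le_trans (ler_pM _ _ (hc _ _ _ n0 k0 e0) (hc' _ _ _ n0 k0 e0)) _ => //.
rewrite /poly_nk_eps mulrACA -natrM -exprD -/(size_measure n k eps).
by apply: poly_nk_eps_mono; rewrite // ?leq_addr ?leq_addl.
Qed.

Lemma poly_exp f e : poly_bounded f -> poly_bounded (fun n k eps => f n k eps ^ e)%N.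
Proof.
move=> hf; elim: e => [|e IHe]; first exact: (poly_const 1).
have [c hc] := poly_mul hf IHe.
by exists c => n k eps n0 k0 e0; rewrite expnS; apply: hc.
Qed.

Lemma poly_n : poly_bounded (fun n _ _ => n).
Proof.
exists 1%N => n k eps n0 k0 e0; rewrite /poly_nk_eps mul1r expr1 -addrA lerDl.
by rewrite addr_ge0 // invr_ge0 ltW.
Qed.

Lemma poly_k : poly_bounded (fun _ k _ => k).
Proof.
exists 1%N => n k eps n0 k0 e0; rewrite /poly_nk_eps mul1r expr1 addrAC lerDr.
by rewrite addr_ge0 // invr_ge0 ltW.
Qed.

Lemma poly_accuracy : poly_bounded (fun _ _ eps => accuracy eps).
Proof.
exists 1%N => n k eps n0 k0 e0; rewrite /poly_nk_eps mul1r expr1 /accuracy -natr1.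
have /andP[h _] : (Num.truncn eps^-1)%:R <= eps^-1 < (Num.truncn eps^-1).+1%:R.
  by rewrite truncn_itv // invr_ge0 ltW.
rewrite addrC lerD //; apply: le_trans (_ : n%:R <= _); first by rewrite ler1n.
by rewrite lerDl.
Qed.

End PolyBounded.

(** An upper bound for all dimensions, loop counts and table sizes of a run. *)
Definition resource (b rmax csparse n k : nat) (eps : rat) : nat :=
  (101 + n + k + rmax + accuracy eps + power b n k (accuracy eps) +
   (n * k + (rounds b n k (accuracy eps) + poly_nk csparse n k)))%N.

Ltac poly_bound :=
  lazymatch goal with
  | |- poly_bounded (fun n k eps => (@?f n k eps + @?g n k eps)%N) =>
      apply: (@poly_add f g); poly_bound
  | |- poly_bounded (fun n k eps => (@?f n k eps * @?g n k eps)%N) =>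
      apply: (@poly_mul f g); poly_bound
  | |- poly_bounded (fun n k eps => (@?f n k eps ^ ?e)%N) =>
      apply: (@poly_exp f e); poly_bound
  | |- poly_bounded (fun n k eps => n) => exact: poly_n
  | |- poly_bounded (fun n k eps => k) => exact: poly_k
  | |- poly_bounded (fun n k eps => accuracy eps) => exact: poly_accuracy
  | |- _ => exact: poly_const
  end.

Lemma poly_resource b rmax csparse : poly_bounded (resource b rmax csparse).
Proof.
cbv beta delta [resource power rounds inv_step shift range penalty poly_nk].
poly_bound.
Qed.

Lemma tensor_max_le (n k : nat) (A : tensor rat n k) (B : rat) j :
  tensor_max A <= B -> `|A j| <= B.
Proof. by move=> h; apply: le_trans h; apply: le_bigmax. Qed.

Theorem corollary7p11 (R : realType) (rmax csparse cbits : nat) (B : rat) :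
  exists (p : program) (c : nat),
  forall (n k r : nat) (u : 'I_r -> 'I_k -> 'I_n -> rat)
    (s : seq (multi_index n k * rat)) (mu : 'I_k -> 'I_n -> rat) (eps : rat),
  let Rt := factored u in
  let St := of_entries s in
  let Q : tensor rat n k := fun j => Rt j + St j in
  (0 < n)%N -> (0 < k)%N ->
  has_rank (to_real R Rt) r -> (r <= rmax)%N ->
  entry_list s -> (size s <= poly_nk csparse n k)%N ->
  (forall j, 0 <= Q j) ->
  tensor_max Rt <= B -> tensor_max St <= B ->
  (forall i, in_simplex (mu i)) ->
  (forall l i a, (bits (u l i a) <= poly_nk cbits n k)%N) ->
  (forall e, e \in s -> (bits e.2 <= poly_nk cbits n k)%N) ->
  (forall i a, (bits (mu i a) <= poly_nk cbits n k)%N) ->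
  0 < eps ->
  exists (t : nat) (sol : seq (multi_index n k * rat)),
  [/\ computes p (enc_input u s mu eps) (enc_entries sol) t,
      t%:R <= poly_nk_eps c n k eps,
      entry_list sol,
      (size sol)%:R <= poly_nk_eps c n k eps &
      suboptimal_projection (fun i a => ratr (mu i a)) (to_real R Q)
        (ratr eps) (to_real R (of_entries sol))].
Proof.
pose b := (Num.truncn B).+1.
have hB x : x <= B -> x <= b%:R.
  by move=> h; apply: le_trans h (ltW (real_truncnS_gt _)); apply: num_real.
have [c hc] := poly_exp (18 + 3 * rmax) (poly_resource b rmax csparse).
exists (prog b), c => -[//|n] k r u s mu eps Rt St Q _ k0 _ hr hs size_s _ hR hS hmu _ _ _ eps0.
pose M := accuracy eps; pose X := resource b rmax csparse n.+1 k eps.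
have hc' := hc n.+1 k eps isT k0 eps0; rewrite -/X in hc'.
have X100 : (100 <= X)%N by rewrite /X /resource -!addnA leq_addr.
have M0 : (0 < M)%N by [].
have le_eps : M%:R^-1 <= eps.
  rewrite -[eps]invrK lef_pV2 ?posrE ?invr_gt0 ?ltr0n //.
  by rewrite ltW // real_truncnS_gt // num_real.
have sizeX : (n.+1 * k + (rounds b n.+1 k M + size s) < X)%N.
  apply: (@leq_ltn_trans (n.+1 * k + (rounds b n.+1 k M + poly_nk csparse n.+1 k))).
    by rewrite !leq_add2l.
  by rewrite /X /resource -/M; lia.
have [t le_t ht] : exists2 t, (t <= budget X (18 + 3 * r))%N &
    computes (prog b) (enc_input u s mu eps)
      (enc_entries (solution b M (mats_of u) (mat_of mu) s)) t.
  apply: main_computes => //; rewrite ?/X ?/resource -/M; try lia.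
have [hsol hopt] := solution_correct k0 M0 hmu hs
  (fun j => hB _ (tensor_max_le j hR)) (fun j => hB _ (tensor_max_le j hS)) R le_eps.
have mono e e' : (e <= e')%N -> (X ^ e <= X ^ e')%N := @budget_mono X X100 e e'.
exists t, (solution b M (mats_of u) (mat_of mu) s); split => //.
  apply: le_trans hc'; rewrite ler_nat; apply: leq_trans le_t _.
  by apply: mono; rewrite leq_add2l leq_mul2l.
apply: le_trans hc'; rewrite ler_nat.
apply: leq_trans (size_solution _ _ _ _ _) _; apply: leq_trans (ltnW sizeX) _.
by rewrite -[X in (X <= _)%N]expn1; apply: mono.
Qed.
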